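(* For every $\epsilon \ge \frac{2}{\chi(G)}$, there is a deterministic distributed algorithm in the LOCAL model that, run on an $n$-node chordal graph $G$ with parameter $\epsilon$, computes a legal vertex coloring of $G$ using at most $(1+\epsilon)\chi(G)$ colors (i.e., a $(1+\epsilon)$-approximation to Minimum Vertex Coloring) in $\mathrm{O}(\frac{1}{\epsilon}\log n)$ rounds.
   Context: A graph is chordal if every cycle on at least four vertices has a chord, i.e., an edge joining two non-consecutive vertices of the cycle. $\chi(G)$ denotes the chromatic number of $G$. In the LOCAL model, the input graph $G=(V,E)$ is the communication network; each node has a unique ID and initially knows only its own ID and its neighbors. Computation proceeds in synchronous rounds; in each round every node performs unlimited local computation and then sends messages of unbounded size to each of its neighbors. The running time is the number of rounds. At termination every node must know its own color.
   Formalization: Node IDs are assumed to lie in {0,…,n^c} for a constant c on which the O-constant may depend (with unbounded IDs the claim fails on paths), and the round bound is O(max(1,1/ε) log n), since for growing ε the literal O((1/ε) log n) fails on trees. *)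

(* Defs.v *)
From HB Require Import structures.
From mathcomp Require Import all_boot.

Set Implicit Arguments.
Unset Strict Implicit.
Unset Printing Implicit Defensive.

Record sgraph := SGraph {
  vertex :> finType;
  adj : rel vertex;
  adj_sym : symmetric adj;
  adj_irrefl : irreflexive adj
}.

(* [next c x] is the successor of [x] on the cycle [c], so [x] and [y] are
   non-consecutive when neither is the successor of the other. *)
Definition has_chord (G : sgraph) (c : seq G) : Prop :=
  exists x y : G,
    [/\ x \in c, y \in c, adj x y, y != next c x & x != next c y].

Definition chordal (G : sgraph) : Prop :=
  forall c : seq G, ucycle (@adj G) c -> 3 < size c -> has_chord c.

Definition legal_coloring (G : sgraph) (K : eqType) (f : G -> K) : bool :=
  [forall u : G, forall v : G, adj u v ==> (f u != f v)].

Definition num_colors (G : sgraph) (K : eqType) (f : G -> K) : nat :=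
  size (undup [seq f v | v : G]).

Definition colorable (G : sgraph) (k : nat) : bool :=
  [exists f : {ffun G -> 'I_k}, legal_coloring f].

Lemma colorable_card (G : sgraph) : exists k, colorable G k.
Proof.
exists #|G|; apply/existsP; exists [ffun v => enum_rank v].
apply/forallP => u; apply/forallP => v; apply/implyP => uv.
rewrite !ffunE (inj_eq enum_rank_inj).
by apply: contraTneq uv => ->; rewrite adj_irrefl.
Qed.

Definition chromatic_number (G : sgraph) : nat := ex_minn (colorable_card G).

(* The same (arbitrary, total) functions are run by every node.
   - [init i ns]: the initial state of a node with ID [i] whose neighbours have
     the IDs [ns], listed in increasing order.  Nothing else is known, in
     particular neither the graph nor its number of nodes.
   - [send s j]: the message sent to the neighbour with ID [j].
   - [step s ms]: the next state, given the messages received, each paired with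
     the ID of its sender, in increasing order of IDs.
   - [output s]: the colour decided by the node, if any.  A decision is
     irrevocable; a node that has decided may go on relaying messages. *)
Record local_algorithm := LocalAlgorithm {
  state : Type;
  message : Type;
  init : nat -> seq nat -> state;
  send : state -> nat -> message;
  step : state -> seq (nat * message) -> state;
  output : state -> option nat;
  output_stable : forall (s : state) (ms : seq (nat * message)) (c : nat),
    output s = Some c -> output (step s ms) = Some c
}.

(* Sorting by ID keeps the enumeration order of the vertex type from breaking
   symmetry. *)
Definition neighbors (G : sgraph) (id : G -> nat) (v : G) : seq G :=
  sort (fun x y => id x <= id y) (enum (adj v)).

Fixpoint run (A : local_algorithm) (G : sgraph) (id : G -> nat) (t : nat) :
    G -> state A :=
  if t is t'.+1 then
    fun v => step (run A id t' v)
      [seq (id u, send (run A id t' u) (id v)) | u <- neighbors id v]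
  else fun v => init A (id v) [seq id u | u <- neighbors id v].

Definition computes_within (A : local_algorithm) (G : sgraph) (id : G -> nat)
    (t : nat) (col : G -> nat) : Prop :=
  forall v : G, output (run A id t v) = Some (col v).

(* Main.v *)
(* Chordal graphs are tree-like: the part of a sphere seen from a connected set
   outside its ball is a clique, hence N[p] separates u from v for every p on a
   geodesic from u to v, which gives a four-point condition for the distance.

   Levels: every vertex has level 0, and a vertex has level i+1 if close to it
   there is a tripod with long legs ending at level i.  Level i+1 forces 2^i
   vertices.  A vertex of exact level i in the middle of a geodesic with both ends
   of level i is a candidate.  The absence of tripods makes candidates locally
   collinear, and a geodesic without candidates has length O(L log n), because the
   level must fall every L steps.

   Select a maximal family of candidates pairwise at distance > W = O(1/eps): a
   ruling set obtained from the bits of the identifiers, completed inside the gaps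
   that it leaves, which have diameter O(W log n) by collinearity.  Each selected
   vertex carries a clique separator, and every component left after removing these
   cliques has diameter O(W log n).  A component can therefore be coloured at once,
   and optimally, around cliques coloured beforehand: a k-colouring can be
   transformed into prescribed colours on far apart cliques with q extra colours,
   since each two steps of distance allow q colour classes to be moved.

   The algorithm gathers its neighbourhood until all graphs consistent with it give
   the same colour. *)
Require Import Defs.
From HB Require Import structures.
From mathcomp Require Import all_boot all_order all_algebra.
From mathcomp Require Import reals exp.
From mathcomp Require Import boolp zify ring lra.

Set Implicit Arguments.
Unset Strict Implicit.
Unset Printing Implicit Defensive.

(** * Walks and distances *)

Inductive reach (T : Type) (r : T -> T -> Prop) (x : T) : T -> Prop :=
| reach_refl : reach r x x
| reach_step y z : reach r x y -> r y z -> reach r x z.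
Arguments reach_refl {T r x}.

Lemma reach_trans (T : Type) (r : T -> T -> Prop) x y z :
  reach r x y -> reach r y z -> reach r x z.
Proof. by move=> xy yz; elim: yz => // u v _ xu uv; apply: reach_step uv. Qed.

Lemma reach_sym (T : Type) (r : T -> T -> Prop) :
  (forall x y, r x y -> r y x) -> forall x y, reach r x y -> reach r y x.
Proof.
move=> rS x y; elim=> [|u v _ ux uv]; first exact: reach_refl.
by apply: reach_trans ux; apply: reach_step reach_refl _; apply: rS.
Qed.

Lemma reach_within_sym (T : Type) (e : T -> T -> Prop) (P : T -> Prop) :
  (forall x y, e x y -> e y x) -> forall x y,
  P x -> reach (fun u v => e u v /\ P v) x y ->
  P y /\ reach (fun u v => e u v /\ P v) y x.
Proof.
move=> eS x y Px; elim=> [|u v _ [Pu ux] [euv Pv]].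
  by split=> //; apply: reach_refl.
split=> //; apply: reach_trans ux; apply: reach_step reach_refl _.
by split=> //; apply: eS.
Qed.

Lemma reach_sub (T : Type) (r r' : T -> T -> Prop) x y :
  (forall u v, reach r x u -> r u v -> r' u v) -> reach r x y -> reach r' x y.
Proof.
move=> sub; elim=> [|u v xu ru uv]; first exact: reach_refl.
by apply: reach_step ru _; apply: sub.
Qed.

Lemma reach_crossing (T : Type) (r : T -> T -> Prop) (P : T -> Prop) x y :
  reach r x y -> P x -> ~ P y ->
  exists u v, [/\ reach r x u, reach r x v, r u v, P u & ~ P v].
Proof.
elim=> [//|u v xu IH uv Px nPv].
have [Pu|nPu] := pselect (P u); last exact: IH.
by exists u, v; split=> //; apply: reach_step uv.
Qed.

Lemma first_crossing (P : nat -> Prop) n :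
  ~ P 0 -> P n -> exists2 i, i < n & ~ P i /\ P i.+1.
Proof.
elim: n => // n IH P0 Pn; have [Pn'|nPn] := pselect (P n); last by exists n.
by have [i lin iP] := IH P0 Pn'; exists i => //; lia.
Qed.

(** The result depends on [x0] and the predicate alone. By extensionality, vertices facing
    equivalent predicates make the same choice, and so agree without communicating. *)
Definition pick_or (T : Type) (x0 : T) (P : T -> Prop) : T :=
  if pselect (exists x, P x) is left h then projT1 (cid h) else x0.

Lemma pick_orP (T : Type) (x0 : T) (P : T -> Prop) :
  (exists x, P x) -> P (pick_or x0 P).
Proof. by rewrite /pick_or; case: pselect => // h _; case: cid. Qed.

Fixpoint near (E : rel nat) (r : nat) (x y : nat) : Prop :=
  if r is s.+1 then near E s x y \/ exists2 z, near E s x z & E z y else x = y.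

Definition conn (E : rel nat) (x y : nat) : Prop := exists r, near E r x y.

(* Junk value: 0 when [x] and [y] are not connected. *)
Definition dist (E : rel nat) (x y : nat) : nat :=
  if pselect (exists r, `[< near E r x y >]) is left h then ex_minn h else 0.

Section Metric.
Variable E : rel nat.

Lemma near_mono r s x y : r <= s -> near E r x y -> near E s x y.
Proof.
move=> /subnK <-; elim: (s - r) => // k IH xy; rewrite addSn; left; exact: IH.
Qed.

Lemma near0 r x : near E r x x.
Proof. exact: (@near_mono 0). Qed.

Lemma near_step r x y z : near E r x y -> E y z -> near E r.+1 x z.
Proof. by move=> xy yz; right; exists y. Qed.

Lemma near1 x y : E x y -> near E 1 x y.
Proof. exact: near_step. Qed.

Lemma near_trans r s x y z : near E r x y -> near E s y z -> near E (r + s) x z.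
Proof.
move=> xy; elim: s z => [|s IH] z; first by rewrite addn0 => <-.
rewrite addnS => -[yz|[w yw wz]]; first by left; apply: IH.
by right; exists w => //; apply: IH.
Qed.

Lemma near_last r x y : near E r x y -> x = y \/ exists z, E z y.
Proof.
elim: r => [|r IH]; first by left.
by case=> [/IH//|[z _ zy]]; right; exists z.
Qed.

Lemma near_conn r x y : near E r x y -> conn E x y.
Proof. by exists r. Qed.

Lemma conn_refl x : conn E x x.
Proof. by exists 0. Qed.

Lemma conn_trans x y z : conn E x y -> conn E y z -> conn E x z.
Proof. by move=> [r xy] [s yz]; exists (r + s); apply: near_trans yz. Qed.

Lemma near_dist x y : conn E x y -> near E (dist E x y) x y.
Proof.
move=> [r xy]; rewrite /dist; case: pselect => [h|[]]; last first.
  by exists r; apply/asboolP.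
by case: ex_minnP => k /asboolP.
Qed.

Lemma dist_le r x y : near E r x y -> dist E x y <= r.
Proof.
move=> xy; rewrite /dist; case: pselect => // h.
by case: ex_minnP => k _; apply; apply/asboolP.
Qed.

Lemma near_distP r x y : conn E x y -> near E r x y <-> dist E x y <= r.
Proof.
move=> cxy; split; first exact: dist_le.
by move=> le; apply: near_mono le _; apply: near_dist.
Qed.

(** The junk value being 0, a positive distance is genuine; this is how a lower bound on [dist]
    doubles as connectedness below. *)
Lemma dist_gt0_conn x y : 0 < dist E x y -> conn E x y.
Proof.
rewrite /dist; case: pselect => // h _; case: h => r /asboolP.
exact: near_conn.
Qed.

Lemma dist_gt_conn k x y : k < dist E x y -> conn E x y.
Proof. by move=> lt; apply: dist_gt0_conn; lia. Qed.

Lemma dist_ge_conn k x y : 0 < k -> k <= dist E x y -> conn E x y.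
Proof. by move=> k0 lt; apply: dist_gt0_conn; lia. Qed.

Lemma distxx x : dist E x x = 0.
Proof. by have := dist_le (near0 0 x); lia. Qed.

Lemma dist_tri x y z : conn E x y -> conn E y z ->
  dist E x z <= dist E x y + dist E y z.
Proof. by move=> /near_dist xy /near_dist yz; apply: dist_le; apply: near_trans yz. Qed.

Lemma dist_eq0 x y : conn E x y -> dist E x y = 0 -> x = y.
Proof. by move=> /near_dist h e; rewrite e in h. Qed.

Hypothesis ES : symmetric E.

Lemma near_sym r x y : near E r x y -> near E r y x.
Proof.
elim: r y => [|r IH] y; first by move=> ->.
case=> [xy|[z xz zy]]; first by left; apply: IH.
rewrite -add1n; apply: (near_trans (y := z)); last exact: IH.
by apply: near1; rewrite ES.
Qed.

Lemma conn_sym x y : conn E x y -> conn E y x.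
Proof. by move=> [r /near_sym h]; exists r. Qed.

Lemma dist_sym x y : dist E x y = dist E y x.
Proof.
have main u v : dist E u v <= dist E v u.
  have [c|n] := pselect (conn E v u); first exact/dist_le/near_sym/near_dist.
  rewrite leqNgt; apply/negP => lt; apply: n; apply: conn_sym.
  by apply: dist_gt_conn lt.
by apply/eqP; rewrite eqn_leq !main.
Qed.

Lemma dist_edge x y z : conn E x y -> E y z -> dist E x z <= (dist E x y).+1.
Proof. by move=> c yz; apply/dist_le/(near_step _ yz)/near_dist. Qed.

Lemma dist_edge_ge x y z : conn E x y -> E y z -> dist E x y <= (dist E x z).+1.
Proof.
move=> c yz; apply: dist_edge; last by rewrite ES.
by apply: conn_trans c _; exists 1; apply: near1.
Qed.

Lemma conn_edge x y z : conn E x y -> E y z -> conn E x z.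
Proof. by move=> c yz; apply: conn_trans c _; exists 1; apply: near1. Qed.

(** On a shortest walk each segment bounds [dist (p i) (p j)] above by [j - i], and a shortfall
    would bring the two ends too close. *)
Lemma geodesic x y : conn E x y -> exists p : nat -> nat,
  [/\ p 0 = x, p (dist E x y) = y,
      forall i, i < dist E x y -> E (p i) (p i.+1),
      forall i, i <= dist E x y -> conn E x (p i)
    & forall i j, i <= j -> j <= dist E x y -> dist E (p i) (p j) = j - i].
Proof.
have walk r u v : near E r u v -> dist E u v = r -> exists p : nat -> nat,
    [/\ p 0 = u, p r = v & forall i, i < r -> E (p i) (p i.+1)].
  elim: r v => [|r IH] v; first by move=> /= -> _; exists (fun=> v).
  case=> [near_uv|[z uz zv]] d; first by have := dist_le near_uv; lia.
  have [|p [p0 pr pE]] := IH z uz.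
    have := dist_le uz; have := dist_edge (near_conn uz) zv; lia.
  exists (fun i => if i <= r then p i else v); split; rewrite ?ltnn //.
  move=> i; rewrite ltnS => ir; rewrite ir; case: ltnP => [lt|ge]; first exact: pE.
  by rewrite (_ : i = r) ?pr //; lia.
move=> c; have [p [p0 pn pE]] := walk _ _ _ (near_dist c) erefl.
set n := dist E x y in p0 pn pE *; exists p.
have seg k i : i + k <= n -> near E k (p i) (p (i + k)).
  elim: k => [|k IH] le; first by rewrite addn0.
  by apply: (near_step (IH _)); rewrite ?addnS; [lia | apply: pE; lia].
have cp i : i <= n -> conn E x (p i).
  by move=> le; exists i; rewrite -p0; apply: (seg i 0).
split=> // i j ij jn.
have := dist_le (seg (j - i) i ltac:(lia)); rewrite (_ : i + (j - i) = j); last by lia.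
have := dist_le (seg i 0 ltac:(lia)); rewrite add0n p0.
have := dist_le (seg (n - j) j ltac:(lia)); rewrite (_ : j + (n - j) = n); last by lia.
have ci := cp i ltac:(lia); have cj := cp j jn.
rewrite pn; have := dist_tri ci (conn_trans (conn_sym ci) c).
have := dist_tri (conn_trans (conn_sym ci) cj) (conn_trans (conn_sym cj) c).
rewrite -/n; lia.
Qed.

End Metric.

(** * Separators of chordal graphs *)

Definition chordal_rel (E : rel nat) : Prop :=
  forall c : seq nat, ucycle E c -> 3 < size c -> exists x y,
    [/\ x \in c, y \in c, E x y, y != next c x & x != next c y].

Lemma path_splice (T : eqType) (e : rel T) x w i j :
  path e x w -> i <= j -> j < size w ->
  e (nth x (x :: w) i) (nth x w j) -> path e x (take i w ++ drop j w).
Proof.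
move=> pw ij jw eij; rewrite cat_path take_path //=.
have -> : last x (take i w) = nth x (x :: w) i.
  rewrite -nth_last size_take (_ : (i < size w) = true); last by lia.
  by case: i ij {eij} => [|i] ij //=; rewrite ?take0 // nth_take //; apply: set_nth_default; lia.
rewrite (drop_nth x jw) /= eij /=.
move: pw; rewrite -{1}(cat_take_drop j w) cat_path => /andP[_].
by rewrite (drop_nth x jw) /= => /andP[].
Qed.

Section Chordal.
Variable E : rel nat.
Hypothesis ES : symmetric E.
Hypothesis EI : irreflexive E.

(** An edge between non-consecutive positions shortcuts the walk, so induction on the length ends
    with none. A repeated vertex would yield such an edge, from its first occurrence to the
    successor of the second. *)
Lemma induced_walk (A : nat -> Prop) p q s :
  path E p (rcons s q) -> (forall x, x \in s -> A x) -> ~ A p -> ~ A q ->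
  p <> q -> ~~ E p q ->
  exists t, [/\ path E p (rcons t q), forall x, x \in t -> A x, 0 < size t,
    uniq (p :: rcons t q)
    & forall i j, i.+1 < j -> j < size t + 2 ->
        ~~ E (nth p (p :: rcons t q) i) (nth p (p :: rcons t q) j)].
Proof.
move=> + + nAp nAq pq nEpq; have [n] := ubnP (size s).
elim: n s => // n IH s lt_sn ps As.
have [[i [j [ij jl eij]]]|ind] := pselect (exists i j,
    [/\ i.+1 < j, j < size s + 2 &
        E (nth p (p :: rcons s q) i) (nth p (p :: rcons s q) j)]).
  apply: (IH (take i s ++ drop j.-1 s)).
  - by rewrite size_cat size_drop size_takel; lia.
  - have le_js : j.-1 <= size s by lia.
    rewrite rcons_cat -drop_rcons // (_ : take i s = take i (rcons s q)); last first.
      by rewrite -cats1 takel_cat //; lia.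
    apply: path_splice => //; [lia|by rewrite size_rcons ltnS|].
    by move: eij; case: (j) ij.
  - move=> x; rewrite mem_cat => /orP[/mem_take|/mem_drop]; exact: As.
have {}ind i j : i.+1 < j -> j < size s + 2 ->
    ~~ E (nth p (p :: rcons s q) i) (nth p (p :: rcons s q) j).
  by move=> ij jl; apply/negP => eij; apply: ind; exists i, j.
exists s; split=> //.
  by case: (s) ps => //=; rewrite andbT => h; rewrite h in nEpq.
have sz : size (p :: rcons s q) = size s + 2 by rewrite /= size_rcons; lia.
apply/(uniqPn p) => -[i [j [ij jl eij]]].
rewrite sz in jl; have [js|js] := leqP j (size s).
  have := ind i j.+1 ltac:(lia) ltac:(lia); rewrite eij.
  by move/(pathP p): ps => /(_ j); rewrite size_rcons => -> //; lia.
(* The last position has no successor; here [q] would equal [p] or lie in [A]. *)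
have je : j = (size s).+1 by lia.
move: eij; rewrite je /= nth_rcons ltnn eqxx.
case: i ij => [|i] ij //=; have lt : i < size s by lia.
by rewrite nth_rcons lt => e; case: nAq; rewrite -e; apply: As; apply: mem_nth.
Qed.

Hypothesis chordE : chordal_rel E.

(** If [p] and [q] were distinct and non-adjacent, chordless walks between them through [A] and
    through [B] would close up to a chordless cycle on at least four vertices. *)
Lemma common_neighbors_adjacent (A B : nat -> Prop) p q s t :
  (forall x y, A x -> B y -> x <> y /\ ~~ E x y) ->
  ~ A p -> ~ A q -> ~ B p -> ~ B q ->
  path E p (rcons s q) -> (forall x, x \in s -> A x) ->
  path E p (rcons t q) -> (forall x, x \in t -> B x) ->
  p = q \/ E p q.
Proof.
move=> AB nAp nAq nBp nBq ps As pt Bt.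
have [->|/eqP pq] := eqVneq p q; first by left.
right; apply: contrapT => /negP nE.
have {s ps As} [s [ps As s0 us inds]] := induced_walk ps As nAp nAq pq nE.
have {t pt Bt} [t [pt Bt t0 ut indt]] := induced_walk pt Bt nBp nBq pq nE.
(* The cycle runs from [p] to [q] through [A] and back through [B], so positions after [q] read [t]
   in reverse. *)
pose w := s ++ q :: rev t; pose c := p :: w.
have szw : size w = size s + size t + 1 by rewrite size_cat /= size_rev; lia.
have cs i : i <= (size s).+1 -> nth p c i = nth p (p :: rcons s q) i.
  case: i => // i /=; rewrite ltnS nth_cat nth_rcons => le.
  by case: ltnP => // ge; rewrite (_ : i = size s) ?subnn ?eqxx //; lia.
have ct i : size s < i -> i <= size w ->
    nth p c i = nth p (p :: rcons t q) (size w - i).+1.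
  case: i => // i lt le /=; rewrite nth_cat (_ : (i < size s) = false); last by lia.
  case e: (i - size s) => [|k] /=.
    rewrite nth_rcons (_ : (_ < size t) = false); last by lia.
    by rewrite (_ : (_ == size t) = true) //; lia.
  rewrite nth_rev; last by lia.
  rewrite nth_rcons (_ : (_ < size t) = true); last by lia.
  by congr nth; lia.
have uc : uniq c.
  move: us ut; rewrite /c /w /= !mem_rcons !inE !rcons_uniq mem_cat inE mem_rev.
  rewrite !negb_or cat_uniq /= rev_uniq mem_rev.
  move=> /and3P[/andP[-> ->] qs ->] /and3P[/andP[_ ->] -> ->]; rewrite /= andbT.
  rewrite negb_or qs /=; apply/hasPn => x; rewrite mem_rev => /Bt Bx.
  by apply/negP => /As Ax; have [] := AB _ _ Ax Bx.
have cc : cycle E c.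
  rewrite /c /w /= -cat_rcons rcons_cat cat_path ps last_rcons /=.
  have := rev_path E p (rcons t q); rewrite last_rcons belast_rcons rev_cons => ->.
  by rewrite -(eq_path (e := E)) // => x y; exact: ES.
have sz3 : 3 < size c by rewrite /= szw; lia.
have ucc : ucycle E c by apply/andP.
have [x [y [xc yc Exy nyx nxy]]] := chordE ucc sz3.
(* The last two conditions exclude consecutive positions, the closing edge included. On one side
   chordlessness of that walk applies, across the sides the separation of [A] from [B]. *)
have nadj i j : i < j -> j <= size w -> j != i.+1 -> (i != 0) || (j != size w) ->
    ~~ E (nth p c i) (nth p c j).
  move=> ij jw ji iw; have [js|js] := leqP j (size s).+1.
    by rewrite !cs; [apply: inds; lia|lia|lia].
  have [is0|is0] := ltnP (size s) i.
    by rewrite !ct; [rewrite ES; apply: indt; lia|lia|lia|lia|lia].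
  rewrite (ct j); [|lia|lia]; have [i0|i0] := eqVneq i 0.
    rewrite i0 [nth p c 0](_ : _ = nth p (p :: rcons t q) 0) //.
    by apply: indt; lia.
  rewrite cs; last by lia.
  have [k ik] : exists k, i = k.+1 by exists i.-1; lia.
  have ks : k < size s by lia.
  have jt : size w - j < size t by lia.
  rewrite ik /= !nth_rcons ks jt.
  by apply: (proj2 (AB _ _ (As _ (mem_nth _ _)) (Bt _ (mem_nth _ _)))).
have nextE z : z \in c -> next c z = nth p w (index z c) by move=> zc; rewrite next_nth zc.
have sizec : size c = (size w).+1 by [].
have bad u v : u \in c -> v \in c -> E u v -> v != next c u -> u != next c v ->
    index u c < index v c -> False.
  move=> uC vC Euv nvu nuv lt; have := vC; rewrite -index_mem sizec ltnS => le.
  have := nadj _ _ lt le; rewrite !nth_index // Euv => H.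
  suff: ~~ true by []; apply: H.
    apply: contraNneq nvu => e; rewrite nextE //.
    by rewrite -[nth p w _]/(nth p c (index u c).+1) -e nth_index.
  rewrite -negb_and; apply: contraNN nuv => /andP[/eqP u0 /eqP ve].
  by rewrite nextE // ve nth_default // -[u](nth_index p uC) u0.
case: (ltngtP (index x c) (index y c)) => [lt|lt|e].
- exact: (bad x y).
- by apply: (bad y x) => //; rewrite ES.
- by have := nth_index p xc; rewrite e nth_index // => eyx; rewrite eyx EI in Exy.
Qed.

(** [p] and [q] are joined inside the open ball through its centre, and outside the closed ball by
    the given walk. No edge runs between these two regions. *)
Lemma sphere_clique a k p q y1 y2 : 0 < k ->
  conn E a p -> conn E a q -> dist E a p = k -> dist E a q = k ->
  E p y1 -> E q y2 -> k < dist E a y1 ->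
  reach (fun x y => E x y /\ k < dist E a y) y1 y2 -> p = q \/ E p q.
Proof.
move=> k0 cp cq dp dq py1 qy2 dy1 y12.
pose A x := conn E a x /\ dist E a x < k; pose B x := k < dist E a x.
have walk P x y : P x -> reach (fun x y => E x y /\ P y) x y -> exists s,
    [/\ path E x s, last x s = y & forall z, z \in x :: s -> P z].
  move=> Px; elim=> [|u v _ [s [ps ls Ps]] [uv Pv]].
    by exists [::]; split=> // z; rewrite inE => /eqP ->.
  exists (rcons s v); rewrite rcons_path ps ls uv last_rcons; split=> // z.
  by rewrite inE mem_rcons inE orbCA -in_cons => /orP[/eqP ->|/Ps].
have close P x y : P x -> reach (fun x y => E x y /\ P y) x y -> E p x -> E y q ->
    exists s, path E p (rcons s q) /\ forall z, z \in s -> P z.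
  move=> Px /(walk _ _ _ Px)[s [ps ls Ps]] px yq.
  by exists (x :: s); rewrite /= px rcons_path ps ls.
have ascend r x : near E r a x -> r < k -> reach (fun x y => E x y /\ A y) a x.
  elim: r x => [|r IH] x /=; first by move=> -> _; apply: reach_refl.
  case=> [ax|[z az zx]] rk; first by apply: IH => //; lia.
  apply: (reach_step (y := z)); first by apply: IH => //; lia.
  split=> //; split; first by apply: conn_edge zx; exists r.
  by have := dist_le (near_step az zx); lia.
have Aa : A a by split; [exact: conn_refl|rewrite distxx].
have inner x : conn E a x -> dist E a x = k -> exists z, [/\ E z x, A z
    & reach (fun x y => E x y /\ A y) a z].
  move=> cx dx; have := near_dist cx; rewrite dx.
  case: k k0 @A @B dx ascend Aa {dp dq dy1 y12} => // k _ A B dx ascend Aa.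
  case=> [/dist_le|[z az zx]]; first by lia.
  exists z; split=> //; last by apply: ascend az _.
  by split; [exists k|have := dist_le az; lia].
have [z1 [z1p Az1 r1]] := inner _ cp dp; have [z2 [z2q Az2 r2]] := inner _ cq dq.
have [|_ r1'] := reach_within_sym (e := E) (P := A) _ Aa r1; first by move=> ? ?; rewrite ES.
have [s [ps As]] : exists s, path E p (rcons s q) /\ forall z, z \in s -> A z.
  by apply: (close A z1 z2) => //; [apply: reach_trans r2|rewrite ES].
have [t [pt Bt]] : exists t, path E p (rcons t q) /\ forall z, z \in t -> B z.
  by apply: (close B y1 y2) => //; rewrite ES.
apply: (common_neighbors_adjacent _ _ _ _ _ ps As pt Bt); rewrite /A /B ?dp ?dq; try lia.
move=> x y [cx dx] dy; split; first by move=> e; rewrite e in dx; lia.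
by apply/negP => xy; have := dist_edge cx xy; lia.
Qed.

Definition beyond a k x y := E x y /\ k < dist E a y.

Lemma beyond_gt a k x y : k < dist E a x -> reach (beyond a k) x y -> k < dist E a y.
Proof. by move=> dx; elim=> // u v _ _ []. Qed.

Lemma beyond_sym a k x y : k < dist E a x ->
  reach (beyond a k) x y -> reach (beyond a k) y x.
Proof.
move=> dx xy; apply: proj2 (_ : _ /\ _).
apply: (reach_within_sym (e := E) (P := fun v => k < dist E a v)) => //.
by move=> ? ?; rewrite ES.
Qed.

Lemma geodesic_beyond a k x y : conn E x y ->
  (forall z, conn E x z -> dist E x z + dist E z y = dist E x y -> k < dist E a z) ->
  reach (beyond a k) x y.
Proof.
move=> cxy out; have [p [p0 pn pE pc pd]] := geodesic ES cxy.
have main i : i <= dist E x y -> reach (beyond a k) x (p i).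
  elim: i => [|i IH] le; first by rewrite p0; apply: reach_refl.
  apply: (reach_step (IH _)); first by lia.
  split; first exact: pE.
  apply: out; first exact: pc.
  have := pd 0 i.+1 isT le; have := pd i.+1 _ le (leqnn _).
  by rewrite p0 pn => -> ->; lia.
by rewrite -pn; apply: main.
Qed.

(** For [p] strictly between the ends, [A] is the complement of the component [Y] of [v] outside the
    ball around [u] of radius [dist E u p]. A geodesic entering [Y] does so from the clique of the
    sphere that faces [Y], and [p] belongs to that clique. *)
Lemma geodesic_separates u v p : conn E u p -> conn E u v -> 0 < dist E u v ->
  dist E u p + dist E p v = dist E u v ->
  exists A : nat -> Prop, [/\ A u, ~ A v & forall x y, conn E u x -> conn E u y ->
    A x -> ~ A y -> exists q, [/\ conn E u q,
      dist E x q + dist E q y = dist E x y & dist E q p <= 1]].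
Proof.
move=> cp cv uv0 upv; have cpv := conn_trans (conn_sym ES cp) cv.
have [k0|k0] := posnP (dist E u p).
  have pu := dist_eq0 cp k0; exists (fun x => x = u); split=> //.
    by move=> vu; rewrite vu distxx in uv0.
  by move=> x y _ _ -> _; exists u; rewrite -pu !distxx; split=> //; apply: conn_refl.
have [pv0|pv0] := posnP (dist E p v).
  have pv := dist_eq0 cpv pv0; exists (fun x => x <> v); split=> //.
    by move=> vu; rewrite vu distxx in uv0.
  by move=> x y cx cy _ /contrapT ->; exists v; rewrite pv !distxx addn0; split.
set k := dist E u p in k0 upv.
pose Y := reach (beyond u k) v.
have vk : k < dist E u v by lia.
have Ygt y : Y y -> k < dist E u y by apply: beyond_gt.
exists (fun x => ~ Y x); split.
- by move=> /Ygt; rewrite distxx.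
- by move=> h; apply: h; apply: reach_refl.
move=> x y cx cy nYx /contrapT Yy.
have cxy := conn_trans (conn_sym ES cx) cy.
have [g [g0 gn gE gc gd]] := geodesic ES cxy.
have [| |i lt [nYi Yi]] := first_crossing (P := fun i => Y (g i)) (n := dist E x y).
- by rewrite g0.
- by rewrite gn.
have ci : conn E u (g i) by apply: conn_trans cx (gc _ _); lia.
have dik : dist E u (g i) = k.
  have := dist_edge ci (gE i lt); have := Ygt _ Yi.
  have [|gt] := leqP (dist E u (g i)) k; first by lia.
  by case: nYi; apply: (reach_step Yi); split=> //; rewrite ES; apply: gE.
(* The successor of [p] on a geodesic to [v] lies in [Y], which puts [p] in the clique. *)
have [f [f0 fn fE fc fd]] := geodesic ES cpv.
have Ef : E p (f 1) by rewrite -{1}f0; apply: fE.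
have Yf : Y (f 1).
  apply: beyond_sym; last first.
    have cf1v : conn E (f 1) v by apply: conn_trans (conn_sym ES (fc 1 pv0)) cpv.
    apply: geodesic_beyond => // z cz zb.
    have c1 : conn E u (f 1) by apply: conn_trans cp (fc 1 pv0).
    have cuz : conn E u z by apply: conn_trans c1 cz.
    have := dist_tri cuz (conn_trans (conn_sym ES cuz) cv).
    have := fd 1 _ pv0 (leqnn _); rewrite fn; lia.
  have c1 : conn E u (f 1) by apply: conn_trans cp (fc 1 pv0).
  have := dist_tri c1 (conn_trans (conn_sym ES c1) cv).
  have := fd 1 _ pv0 (leqnn _); rewrite fn; lia.
exists (g i); split=> //.
  have := gd 0 i isT (ltnW lt); have := gd i _ (ltnW lt) (leqnn _).
  by rewrite g0 gn => -> ->; lia.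
have [] := sphere_clique k0 ci cp dik erefl (gE i lt) Ef (Ygt _ Yi).
- by apply: (reach_trans (beyond_sym vk Yi)).
- by move=> ->; rewrite distxx.
- by move=> e; apply: dist_le; apply: near1.
Qed.
End Chordal.

(* The clique at distance [L] from [a] cutting off the component of [b]; the
   bound [2 * L] makes the definition local. *)
Definition cutset (E : rel nat) (L s a b x : nat) : Prop :=
  [/\ near E 1 s x, dist E a x = L & exists2 y, E x y
    & reach (fun u v => E u v /\ L < dist E a v <= 2 * L) b y].

(** * Clique cutsets between two far points *)

Section Cut.
Variable E : rel nat.
Hypothesis ES : symmetric E.
Hypothesis EI : irreflexive E.
Hypothesis chordE : chordal_rel E.
Variables (L s a b : nat).
Hypothesis L0 : 0 < L.
Hypothesis sa : dist E s a = L.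
Hypothesis sb : dist E s b = L.
Hypothesis ab : dist E a b = 2 * L.

Let ca : conn E a s. Proof. by apply: conn_sym => //; apply: dist_gt0_conn; lia. Qed.
Let csb : conn E s b. Proof. by apply: dist_gt0_conn; lia. Qed.
Let cab : conn E a b. Proof. exact: conn_trans ca csb. Qed.
Let as_ : dist E a s = L. Proof. by rewrite dist_sym. Qed.
Let bL : L < dist E a b. Proof. by lia. Qed.

(** A walk that exceeds distance [2 * L] comes back through the clique by which it left, so at most
    one edge replaces the excursion. The induction remembers the exit edge from [e] to [f]. *)
Lemma shell_beyond y : reach (beyond E a L) b y -> dist E a y <= 2 * L ->
  reach (fun u v => E u v /\ L < dist E a v <= 2 * L) b y.
Proof.
set shell := fun _ => _.
suff main : reach (beyond E a L) b y ->
    (dist E a y <= 2 * L /\ reach shell b y) \/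
    (2 * L < dist E a y /\ exists e f, [/\ reach shell b e, dist E a e = 2 * L, E e f,
       2 * L < dist E a f & reach (beyond E a (2 * L)) f y]).
  by move=> /main[[]//|[]]; lia.
elim=> [|u v bu IH [uv Lv]]; first by left; rewrite ab; split=> //; apply: reach_refl.
have cau : conn E a u by apply: dist_gt_conn (beyond_gt bL bu).
have duv := dist_edge cau uv; have duv' := dist_edge_ge ES cau uv.
have [le|gt] := leqP (dist E a v) (2 * L).
  left; split=> //; case: IH => [[_ su]|[gtu [e [f [se de ef df fu]]]]].
    by apply: (reach_step su); split=> //; apply/andP.
  have dv : dist E a v = 2 * L by lia.
  have ce : conn E a e by apply: dist_gt0_conn; lia.
  have cv : conn E a v by apply: dist_gt0_conn; lia.
  have [||<-//|ev] := sphere_clique ES EI chordE _ ce cv de dv ef _ df fu; first by lia.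
    by rewrite ES.
  by apply: (reach_step se); split=> //; apply/andP.
right; split=> //; case: IH => [[le su]|[gtu [e [f [se de ef df fu]]]]].
  by exists u, v; split=> //; [lia|apply: reach_refl].
by exists e, f; split=> //; apply: reach_step fu _.
Qed.

Lemma shell_sub y : reach (fun u v => E u v /\ L < dist E a v <= 2 * L) b y ->
  reach (beyond E a L) b y.
Proof. by apply: reach_sub => u v _ [uv /andP[? _]]. Qed.

Lemma cutset_adj x y : cutset E L s a b x -> cutset E L s a b y -> x = y \/ E x y.
Proof.
move=> [_ dx [x' xx' /shell_sub bx']] [_ dy [y' yy' /shell_sub by']].
have cx : conn E a x by apply: dist_gt0_conn; lia.
have cy : conn E a y by apply: dist_gt0_conn; lia.
apply: (sphere_clique ES EI chordE L0 cx cy dx dy xx' yy' (beyond_gt bL bx')).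
exact: reach_trans (beyond_sym ES bL bx') by'.
Qed.

(** [s] lies on a geodesic from [a] to [b], at distance [L] from [a], so it belongs to the clique
    facing [b]. *)
Lemma cutset_near x y : dist E a x = L -> E x y -> reach (beyond E a L) b y ->
  near E 1 s x.
Proof.
move=> dx xy bY; have cx : conn E a x by apply: dist_gt0_conn; lia.
have [f [f0 fn fE fc fd]] := geodesic ES csb.
have s1 : 1 <= dist E s b by lia.
have Ef : E s (f 1) by rewrite -{1}f0; apply: fE.
have Yf : reach (beyond E a L) b (f 1).
  have c1 : conn E a (f 1) by apply: conn_trans ca (fc 1 s1).
  have d1b : dist E (f 1) b = dist E s b - 1 by rewrite -{1}fn fd.
  apply: beyond_sym => //; last first.
    apply: (geodesic_beyond ES); first exact: conn_trans (conn_sym ES c1) cab.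
    move=> z cz zb.
    have caz : conn E a z by apply: conn_trans c1 cz.
    have := dist_tri caz (conn_trans (conn_sym ES caz) cab); lia.
  have := dist_tri c1 (conn_trans (conn_sym ES c1) cab); lia.
have [] := sphere_clique ES EI chordE L0 ca cx as_ dx Ef xy (beyond_gt bL Yf).
- exact: reach_trans (beyond_sym ES bL Yf) bY.
- by move=> ->; apply: near0.
- exact: near1.
Qed.

Lemma cutset_boundary x y : dist E a x = L -> E x y -> reach (beyond E a L) b y ->
  cutset E L s a b x.
Proof.
move=> dx xy bY; split=> //; first exact: cutset_near bY.
exists y => //; apply: shell_beyond => //.
have cx : conn E a x by apply: dist_gt0_conn; lia.
by have := dist_edge cx xy; lia.
Qed.

(** Being closer to [b], [v] lies in the component of [b] beyond [L], which a walk avoiding the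
    clique cannot leave. A geodesic from [a] to [u] then crosses within 1 of [s], whence
    [dist E b u <= dist E a u + 1]. *)
Lemma cutset_separates u v : conn E a v ->
  reach (fun x y => E x y /\ ~ cutset E L s a b y) v u ->
  dist E b v < dist E a v -> dist E a u + 1 < dist E b u -> False.
Proof.
move=> cav vu bv au.
have cbv : conn E b v := conn_trans (conn_sym ES cab) cav.
have bY : reach (beyond E a L) b v.
  apply: geodesic_beyond => // z cz zb; rewrite ltnNge; apply/negP => le.
  have caz : conn E a z := conn_trans cab cz.
  have := dist_tri caz (conn_trans (conn_sym ES caz) cab).
  have := dist_tri caz (conn_trans (conn_sym ES caz) cav).
  rewrite (dist_sym ES z b); lia.
have {bv} bu : reach (beyond E a L) b u.
  elim: vu {au} => // x y _ bx [xy ncy].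
  have cx : conn E a x by apply: dist_gt_conn (beyond_gt bL bx).
  have [gt|le] := ltnP L (dist E a y); first by apply: reach_step bx _.
  case: ncy; apply: (cutset_boundary (y := x)) => //; last by rewrite ES.
  have := dist_edge_ge ES cx xy; have := beyond_gt bL bx; lia.
have uL := beyond_gt bL bu; have cau : conn E a u by apply: dist_gt_conn uL.
have [g [g0 gn gE gc gd]] := geodesic ES cau.
have Eg := gE L uL; have cw := gc L (ltnW uL); have cw' := gc _ uL.
have dw : dist E a (g L) = L by rewrite -{1}g0 gd //; lia.
have dw'u : dist E (g L.+1) u = dist E a u - L.+1 by rewrite -{1}gn gd.
have dwu : dist E (g L) u = dist E a u - L by rewrite -{1}gn gd //; lia.
have nw : near E 1 s (g L).
  apply: (cutset_near dw Eg); apply: reach_trans bu _; apply: beyond_sym => //; last first.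
    apply: (geodesic_beyond ES); first exact: conn_trans (conn_sym ES cw') cau.
    move=> z cz zb; have caz : conn E a z := conn_trans cw' cz.
    have := dist_tri caz (conn_trans (conn_sym ES caz) cau); lia.
  have := dist_tri cw' (conn_trans (conn_sym ES cw') cau); lia.
have := dist_le nw; have csw : conn E s (g L) by exists 1.
have cbs := conn_sym ES csb.
have := dist_tri cbs csw.
have := dist_tri (conn_trans cbs csw) (conn_trans (conn_sym ES cw) cau).
rewrite (dist_sym ES b s); lia.
Qed.
End Cut.

(** * Levels and candidates in a hyperbolic metric *)

Section Hyperbolic.
Variables (T : eqType) (d : T -> T -> nat).
Hypothesis dxx : forall x, d x x = 0.
Hypothesis dC : forall x y, d x y = d y x.
Hypothesis dT : forall x y z, d x z <= d x y + d y z.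
Hypothesis geo : forall x y, exists p : nat -> T,
  [/\ p 0 = x, p (d x y) = y
    & forall i j, i <= j -> j <= d x y -> d (p i) (p j) = j - i].
(* A point of a geodesic from [u] to [v] blocks, up to distance 1, every
   geodesic leaving a certain set that contains [u] but not [v]. *)
Hypothesis sep : forall u v p, 0 < d u v -> d u p + d p v = d u v ->
  exists A : T -> Prop, [/\ A u, ~ A v & forall x y, A x -> ~ A y ->
    exists q, d x q + d q y = d x y /\ d q p <= 1].

Ltac dlia := intros; repeat match goal with
  | H : context [d ?a ?b] |- _ =>
      lazymatch goal with _ : d a b = d b a |- _ => fail | _ => pose proof (dC a b) end
  | |- context [d ?a ?b] =>
      lazymatch goal with _ : d a b = d b a |- _ => fail | _ => pose proof (dC a b) end
  end; lia.

(** A geodesic joining [w] to the end on the other side of the separation passes within 1 of [p], so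
    a detour through [p] costs at most 2. *)
Lemma thin_triangle u v p w : d u p + d p v = d u v ->
  d u p + d p w <= d u w + 2 \/ d v p + d p w <= d v w + 2.
Proof.
move=> upv; have [uv0|uv0] := posnP (d u v).
  by left; have := dT p u w; dlia.
have [A [Au nAv cross]] := sep uv0 upv; have [Aw|nAw] := pselect (A w).
  right; have [q [qb qp]] := cross _ _ Aw nAv.
  have := dT v q p; have := dT p q w; dlia.
left; have [q [qb qp]] := cross _ _ Au nAw.
have := dT u q p; have := dT p q w; dlia.
Qed.

(** Each point of a geodesic from [x] to [y] is almost on the way to [z], and to [w], from one of
    the ends. Different ends for [z] and [w] give the claim at once; if they always agree, it arises
    where they switch from [x] to [y], or at [x] itself. *)
Lemma four_point x y z w :
  d x y + d z w <= d x z + d y w + 6 \/ d x y + d z w <= d x w + d y z + 6.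
Proof.
have [p [p0 pn pd]] := geo x y; set n := d x y in pn pd *.
have px i : i <= n -> d x (p i) = i by move=> le; rewrite -p0 pd // subn0.
have py i : i <= n -> d (p i) y = n - i by move=> le; rewrite -pn pd.
pose P i := d y (p i) + d (p i) z <= d y z + 2 /\ d y (p i) + d (p i) w <= d y w + 2.
have [|bad] := pselect (exists2 i, i <= n &
    (d x (p i) + d (p i) z <= d x z + 2 /\ d y (p i) + d (p i) w <= d y w + 2) \/
    (d y (p i) + d (p i) z <= d y z + 2 /\ d x (p i) + d (p i) w <= d x w + 2)).
  case=> i le; have := px i le; have := py i le; have := dT z (p i) w; dlia.
have dich i : i <= n -> ~ P i ->
    d x (p i) + d (p i) z <= d x z + 2 /\ d x (p i) + d (p i) w <= d x w + 2.
  move=> le nP; have b : d x (p i) + d (p i) y = n by rewrite px // py //; lia.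
  have [hz|hz] := thin_triangle z b; have [hw|hw] := thin_triangle w b => //.
  - by case: bad; exists i => //; left.
  - by case: bad; exists i => //; right.
  - by case: nP.
have [P0|nP0] := pselect (P 0).
  by case: P0; rewrite p0; have := dT z x w; rewrite /n; dlia.
have Pn : P n by rewrite /P pn dxx; lia.
have [i li [nPi [Pz Pw]]] := first_crossing nP0 Pn.
have [xz xw] := dich i ltac:(lia) nPi.
(* Two detours cost 4, and the unit gap from [p i] to [p i.+1] counts twice, hence the 6. *)
have := px i ltac:(lia); have := py i.+1 li; have := pd i i.+1 ltac:(lia) li.
have := dT z (p i) w; have := dT (p i) (p i.+1) w; dlia.
Qed.

Variables (W R L0 L1 L : nat).
(* Candidates are compared within 7 W, so a tripod arising from two of them has its
   centre within R = 14 W of both; then L0 > R, L = L0 + R and L1 = L + R. *)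
Hypothesis W_large : 200 <= W.
Hypothesis RE : R = 14 * W.
Hypothesis L0E : L0 = 15 * W.
Hypothesis LE : L = 29 * W.
Hypothesis L1E : L1 = 43 * W.

Variable lev : nat -> T -> Prop.
Definition arm i y a := lev i a /\ L0 <= d y a <= L1.
Definition spread y a b := d y a + d y b <= d a b + 12.
Hypothesis lev0 : forall x, lev 0 x.
Hypothesis levS : forall i x, lev i.+1 x <-> exists y, d x y <= R /\
  exists a1 a2 a3, [/\ arm i y a1, arm i y a2 & arm i y a3] /\
    [/\ spread y a1 a2, spread y a1 a3 & spread y a2 a3].

Lemma lev_anti i j x : i <= j -> lev j x -> lev i x.
Proof.
have step k : forall y, lev k.+1 y -> lev k y.
  elim: k => [//|k IH] y /levS[z [yz [a1 [a2 [a3 [[A1 A2 A3] s]]]]]].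
  apply/levS; exists z; split=> //; exists a1, a2, a3; split=> //.
  by split; [move: A1|move: A2|move: A3] => -[/IH la b].
move=> /subnK <-; elim: (j - i) => // k IH; rewrite addSn => /step; exact: IH.
Qed.

(* [s] enumerates points on the same side of [z] as [x]; at a tripod centre [y]
   near [x] at least two legs lead away from [z], hence the doubling. *)
Lemma lev_cone i : forall z x, lev i x -> L0 <= d z x ->
  exists s : seq T, [/\ uniq s, 2 ^ i <= size s &
    forall w, w \in s -> d x w + 25 <= d z x + d z w].
Proof.
elim: i => [|i IH] z x lx zx.
  exists [:: x]; split=> // w; rewrite inE => /eqP ->; rewrite dxx; lia.
have /levS[y [xy [a1 [a2 [a3 [[A1 A2 A3] [s12 s13 s23]]]]]]] := lx.
have choose a b : arm i y a -> arm i y b -> spread y a b ->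
    d y z + d y a <= d z a + 18 -> d y z + d y b <= d z b + 18 ->
    exists s : seq T, [/\ uniq s, 2 ^ i.+1 <= size s &
      forall w, w \in s -> d x w + 25 <= d z x + d z w].
  move=> [la /andP[ya _]] [lb /andP[yb _]]; rewrite /spread => sab za zb.
  have [s1 [u1 sz1 c1]] := IH y a la ya; have [s2 [u2 sz2 c2]] := IH y b lb yb.
  exists (s1 ++ s2); split.
  - rewrite cat_uniq u1 u2 andbT /=; apply/hasPn => w /c2 cb; apply/negP => /c1 ca.
    by have := four_point a b w y; dlia.
  - by rewrite size_cat expnS; lia.
  have side c : L0 <= d y c -> d y z + d y c <= d z c + 18 ->
      forall w, d c w + 25 <= d y c + d y w -> d x w + 25 <= d z x + d z w.
    move=> yc zc w cw; have := four_point w y z c.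
    have := dT x y w; have := dT z y x; dlia.
  by move=> w; rewrite mem_cat => /orP[/c1|/c2]; apply: side.
have most a b : spread y a b ->
    d y z + d y a <= d z a + 18 \/ d y z + d y b <= d z b + 18.
  rewrite /spread => sab; have := four_point a b z y; dlia.
have [h1|h1] := most _ _ s12; have [h2|h2] := most _ _ s13; have [h3|h3] := most _ _ s23.
all: by [apply: (choose a1 a2)|apply: (choose a1 a3)|apply: (choose a2 a3)].
Qed.

(** The end of a tripod leg has level [i] and is at distance at least [L0] from the centre, as
    [lev_cone] requires. So levels are logarithmic in the number of points. *)
Lemma lev_bound n i x : (forall s : seq T, uniq s -> size s <= n) ->
  lev i.+1 x -> 2 ^ i <= n.
Proof.
move=> fin /levS[y [_ [a1 [_ [_ [[[l1 /andP[y1 _]] _ _] _]]]]]].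
by have [s [us sz _]] := lev_cone l1 y1; apply: leq_trans sz (fin _ us).
Qed.

(** * Armed vertices, on geodesics and close to one another *)

Definition armed i x a b :=
  [/\ lev i x, ~ lev i.+1 x, lev i a, lev i b
    & [/\ d x a = L, d x b = L & d a b = 2 * L]].

Lemma armedC i x a b : armed i x a b -> armed i x b a.
Proof. by move=> [? ? ? ? [? ? ?]]; split=> //; split=> //; rewrite dC. Qed.

Definition is_geodesic n (p : nat -> T) :=
  forall i j, i <= j -> j <= n -> d (p i) (p j) = j - i.

Lemma level_exists K x : ~ lev K x -> exists2 i, i < K & lev i x /\ ~ lev i.+1 x.
Proof.
elim: K => [|K IH] nK; first by case: nK.
have [lK|nlK] := pselect (lev K x); first by exists K.
by have [i lt] := IH nlK; exists i => //; lia.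
Qed.

(* Without an armed vertex the level strictly drops every [L] steps. *)
Lemma level_fall n p : is_geodesic n p ->
  (forall t i, L <= t -> t + L <= n -> ~ armed i (p t) (p (t - L)) (p (t + L))) ->
  forall i t, L <= t -> t <= n -> lev i (p t) -> ~ lev i.+1 (p t) ->
  lev i (p (t - L)) -> n < t + L * i.+1.
Proof.
move=> gp noarm; elim/ltn_ind=> i IH t Lt tn lt nlt lt'.
have [//|le] := ltnP n (t + L); first by rewrite mulnS; lia.
(* Otherwise [p t] would be armed; the induction goes on from [t + L] with a level below [i]. *)
have nl : ~ lev i (p (t + L)).
  move=> l; apply: (noarm t i) => //; split=> //.
  by rewrite dC !gp; [split; lia|lia..].
have [j ji [lj nlj]] := level_exists nl.
have : n < t + L + L * j.+1.
  apply: IH => //; first by lia.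
  by rewrite addnK; apply: lev_anti lt; lia.
have : L * j.+1 <= L * i by rewrite leq_mul2l ji orbT.
rewrite mulnS; lia.
Qed.

(** The vertex at [t = L * K.+1] has exact level [i < K]. It is armed if both vertices [L] away have
    level [i]; otherwise the level falls towards one side and runs out before that end. The left
    side is read on the reversed geodesic [q]. *)
Lemma armed_on_geodesic K n p : (forall x, ~ lev K x) -> is_geodesic n p ->
  2 * L * K.+1 <= n ->
  exists t i, [/\ L <= t, t + L <= n & armed i (p t) (p (t - L)) (p (t + L))].
Proof.
move=> noK gp le; apply: contrapT => noarm.
have {}noarm t i : L <= t -> t + L <= n -> ~ armed i (p t) (p (t - L)) (p (t + L)).
  by move=> h1 h2 h3; apply: noarm; exists t, i.
pose q t := p (n - t).
have gq : is_geodesic n q by move=> i j ij jn; rewrite /q dC gp; lia.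
have noarm' t i : L <= t -> t + L <= n -> ~ armed i (q t) (q (t - L)) (q (t + L)).
  move=> Lt tn /armedC; rewrite /q (_ : n - (t + L) = n - t - L); last by lia.
  by rewrite (_ : n - (t - L) = n - t + L); [apply: noarm; lia|lia].
pose t := L * K.+1; have LK : L <= t by rewrite /t mulnS; lia.
have tn : 2 * t <= n by rewrite /t mulnA.
have [i iK [li nli]] := level_exists (noK (p t)).
have fall j : j < i -> L + L * j.+1 <= t.
  move=> ji; have : L * j.+1 <= L * K by rewrite leq_mul2l; lia.
  by rewrite /t mulnS; lia.
have [lb|nlb] := pselect (lev i (p (t + L))); last first.
  have [j ji [lj nlj]] := level_exists nlb.
  have : n < t + L + L * j.+1.
    apply: (level_fall gp noarm) => //; [lia|lia|].
    by rewrite addnK; apply: lev_anti li; lia.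
  by have := fall _ ji; lia.
have [la|nla] := pselect (lev i (p (t - L))); last first.
  have [j ji [lj nlj]] := level_exists nla.
  have e : n - (n - t + L) = t - L by lia.
  have : n < n - t + L + L * j.+1.
    apply: (level_fall gq noarm'); rewrite /q ?e //; [lia|lia|].
    by rewrite addnK (_ : n - (n - t) = t); [apply: lev_anti li; lia|lia].
  by have := fall _ ji; lia.
apply: (noarm t i) => //; first by lia.
by split=> //; rewrite dC !gp; [split; lia|lia..].
Qed.

(** Half of [d x a' + d x a - d a' a] is the Gromov product at [x], the length along which geodesics
    to [a'] and [a] run together. Were it below [7 * W], the point [y] where they part would be the
    centre of a tripod with legs to [a], [b], [a'], raising the level of [x] if [i <= j] and of [x']
    otherwise. *)
Lemma branch_free i j x x' a b a' b' : armed i x a b -> armed j x' a' b' ->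
  d x x' <= 7 * W -> d x a' + d x b <= d a' b + (d x a' + d x a - d a' a) ->
  14 * W + d a' a <= d x a' + d x a.
Proof.
move=> [lx nlx la lb [xa xb ab]] [lx' nlx' la' _ [xa' _ _]] xx' big.
rewrite leqNgt; apply/negP => small.
have tri1 := dT a' x a; have tri2 := dT x a a'; have tri3 := dT x a' a.
pose m := (d x a' + d x a - d a' a)./2.
have hm : 2 * m <= d x a' + d x a - d a' a <= 2 * m + 1 by rewrite /m; lia.
have [p [p0 pn pd]] := geo x a; pose y := p m.
have mL : m <= d x a by lia.
have xy : d x y = m by have := pd 0 m isT mL; rewrite p0 subn0.
have ya : d y a = L - m by have := pd m _ mL (leqnn _); rewrite pn xa.
have ya' : d y a' + m <= d x a' + 6 by have := four_point y a' x a; dlia.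
have small' : d x a' + d x b <= d a' b + 6 \/ d x a' + d x a <= d a' a + 6.
  by have := four_point a b a' x; dlia.
have yb : d y b <= L + m by have := dT y x b; dlia.
have yb' : L <= d y b + m by have := dT x y b; dlia.
have yx' : d y x' <= 14 * W by have := dT y x x'; dlia.
have y1 : d y a' <= L + 14 * W by have := dT y x' a'; dlia.
have y2 : L <= d y a' + 14 * W by have := dT x' y a'; dlia.
have branch k : lev k a -> lev k b -> lev k a' -> forall z, d z y <= R -> lev k.+1 z.
  move=> ka kb ka' z zy; apply/levS; exists y; split=> //; exists a, b, a'.
  split; first by split; split=> //; lia.
  by split; rewrite /spread; dlia.
have [ij|ji] := leqP i j.
  by apply: nlx; apply: branch => //; [apply: lev_anti la'|dlia].
by apply: nlx'; apply: branch => //; [apply: lev_anti la|apply: lev_anti lb|dlia]; lia.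
Qed.

Lemma arm_match i j x x' a b a' b' : armed i x a b -> armed j x' a' b' ->
  d x x' <= 7 * W ->
  14 * W + d a' a <= d x a' + d x a \/ 14 * W + d a' b <= d x a' + d x b.
Proof.
move=> X X' xx'; have tri1 := dT a' x a; have tri2 := dT a' x b.
have [le|gt] := leqP (d x b + d a' a) (d x a + d a' b).
  by left; apply: (branch_free X X') => //; dlia.
by right; apply: (branch_free (armedC X) X') => //; dlia.
Qed.

(** Seen from [x], one of [a'] and [b'] lies beyond [x']. It runs along an arm of [x] for at least
    [7 * W], hence past [x'], which is therefore close to that arm. *)
Lemma armed_on_line i j x x' a b a' b' : armed i x a b -> armed j x' a' b' ->
  d x x' <= 7 * W -> d x' a + d x x' <= L + 12 \/ d x' b + d x x' <= L + 12.
Proof.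
move=> X X' xx'; have ma := arm_match X X' xx'; have mb := arm_match X (armedC X') xx'.
have [_ _ _ _ [xa xb ab]] := X; have [_ _ _ _ [xa' xb' ab']] := X'.
have h0 := four_point a' b' x x'.
have h1 := four_point x a' x' a; have h2 := four_point x a' x' b.
have h3 := four_point x b' x' a; have h4 := four_point x b' x' b.
have [s|s] : d x' x + d x' a' <= d x a' + 6 \/ d x' x + d x' b' <= d x b' + 6 by dlia.
  by clear h0 h3 h4 mb; case: ma; dlia.
by clear h0 h1 h2 ma; case: mb; dlia.
Qed.

(** [u] and [v] lie beyond opposite arms of [p]. The arms of [s] match different arms of [p], as two
    ends running along the same arm would be closer than [2 * L]. The conclusion is what
    [cutset_separates] asks for. *)
Lemma armed_separates i j p s a0 b0 a b u v :
  armed i p a0 b0 -> armed j s a b -> d p s <= W ->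
  d u a0 + L = d u p -> d v b0 + L = d v p ->
  (d a u + 1 < d b u /\ d b v + 1 < d a v) \/
  (d b u + 1 < d a u /\ d a v + 1 < d b v).
Proof.
move=> P S ps ua vb.
have ps7 : d p s <= 7 * W by lia.
have ma := arm_match P S ps7; have mb := arm_match P (armedC S) ps7.
have [_ _ _ _ [pa pb ab0]] := P; have [_ _ _ _ [sa sb ab]] := S.
have pab1 : d p a <= L + W by have := dT p s a; dlia.
have pab2 : d p b <= L + W by have := dT p s b; dlia.
have pab3 : L <= d p a + W by have := dT s p a; dlia.
have pab4 : L <= d p b + W by have := dT s p b; dlia.
have side c e w c0 : 14 * W + d c c0 <= d p c + d p c0 -> d w c0 + L = d w p ->
    d p c0 = L -> d c e = 2 * L -> d p c <= L + W -> d p e <= L + W -> L <= d p c + W ->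
    L <= d p e + W -> d c w + 1 < d e w.
  move=> m wc pc ce h1 h2 h3 h4.
  have g1 : d p w + d p c >= d w c + 14 * W - 6.
    by have := four_point p c0 w c; have := dT w p c; dlia.
  by have := four_point p w c e; dlia.
have [maa|mab] := ma; have [mba|mbb] := mb.
- by have := four_point p a0 a b; dlia.
- by left; split; [apply: (side a b u a0)|apply: (side b a v b0)] => //; dlia.
- by right; split; [apply: (side b a u a0)|apply: (side a b v b0)] => //; dlia.
- by have := four_point p b0 a b; dlia.
Qed.

(** * Chains of candidates far from a ruling set *)

Definition candidate x := exists i a b, armed i x a b.

Variables (ruler X : T -> Prop).
Hypothesis X_cand : forall x, X x -> candidate x.
Hypothesis X_far : forall x r, X x -> ruler r -> W < d x r.
Fixpoint hops k z := ruler z \/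
  if k is l.+1 then exists z', [/\ candidate z', d z z' <= W & hops l z'] else False.
Variable k : nat.
Hypothesis cand_hops : forall z, candidate z -> hops k z.

Section Component.
Variables (u v : T).
Hypothesis uX : X u.
Hypothesis uv : reach (fun x y => d x y <= W /\ X y) u v.
Hypothesis uv0 : 0 < d u v.
Variable p : nat -> T.
Hypothesis p0 : p 0 = u.
Hypothesis pn : p (d u v) = v.
Hypothesis gp : is_geodesic (d u v) p.

(** [p t] separates [u] from [v] up to distance 1, so some step of the chain crosses next to it; the
    nearer end of a step of length [W] is within [W / 2 + 1]. *)
Lemma chain_dense t : t <= d u v -> exists2 x, X x & 2 * d x (p t) <= W + 2.
Proof.
move=> le; have [|A [Au nAv cross]] := sep (p := p t) uv0.
  have := gp (i := 0) isT le; have := gp le (leqnn _); rewrite p0 pn; lia.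
have [x [y [ux uy [xy Xy] Ax nAy]]] := reach_crossing uv Au nAv.
have Xx : X x by case: ux => // ? ? _ [].
have [q [qb qp]] := cross _ _ Ax nAy.
have := dT x q (p t); have := dT y q (p t).
have [le'|gt] := leqP (d x q) (d q y).
  by exists x => //; dlia.
by exists y => //; dlia.
Qed.

(** Chain members [xl] and [xr] near [p (t - 5 * W)] and [p (t + 5 * W)] lie along opposite arms of
    a member [x] near [p t], and [y] along one of these arms. So [y] is almost between [xl] and
    [xr]. The offset [5 * W] keeps them within [7 * W] of [x]. *)
Lemma candidate_near_line y t : candidate y -> d y (p t) <= 2 * W ->
  6 * W <= t -> t + 6 * W <= d u v -> exists2 t', t' <= d u v & d y (p t') <= 60.
Proof.
move=> [iy [ay [by_ Y]]] yt t1 t2.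
have [x Xx xt] := chain_dense (t := t) ltac:(lia).
have [xl Xl xlt] := chain_dense (t := t - 5 * W) ltac:(lia).
have [xr Xr xrt] := chain_dense (t := t + 5 * W) ltac:(lia).
set ql := p (t - 5 * W) in xlt; set qr := p (t + 5 * W) in xrt.
have lr : d ql qr = 10 * W by rewrite gp; lia.
have lt : d ql (p t) = 5 * W by rewrite gp; lia.
have rt : d (p t) qr = 5 * W by rewrite gp; lia.
have [i [a [b XA]]] := X_cand Xx.
have [il [al [bl XL]]] := X_cand Xl; have [ir [ar [br XR]]] := X_cand Xr.
have exl1 : d x xl <= 6 * W + 2.
  by have := dT x (p t) xl; have := dT (p t) ql xl; dlia.
have exl2 : 4 * W <= d x xl + 2.
  by have := dT (p t) x xl; have := dT (p t) xl ql; dlia.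
have exr1 : d x xr <= 6 * W + 2.
  by have := dT x (p t) xr; have := dT (p t) qr xr; dlia.
have exr2 : 4 * W <= d x xr + 2.
  by have := dT (p t) x xr; have := dT (p t) xr qr; dlia.
have exy : 2 * d x y <= 5 * W + 2 by have := dT x (p t) y; dlia.
have elr : 9 * W <= d xl xr + 2.
  by have := dT ql xl qr; have := dT xl xr qr; dlia.
have onl := armed_on_line XA XL ltac:(lia).
have onr := armed_on_line XA XR ltac:(lia).
have ony := armed_on_line XA Y ltac:(lia).
have [_ _ _ _ [xa xb ab]] := XA.
have gy : d y xl + d y xr <= d xl xr + 42.
  (* Distances from [x] add up along opposite arms and subtract along the same arm. *)
  have opp c c' w w' : d x c = L -> d c c' = 2 * L -> d w c + d x w <= L + 12 ->
      d w' c' + d x w' <= L + 12 -> d x w + d x w' <= d w w' + 24.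
    by move=> h1 h2 h3 h4; have := dT c w c'; have := dT w w' c'; dlia.
  have same c w w' : d x c = L -> d w c + d x w <= L + 12 ->
      d w' c + d x w' <= L + 12 -> d x w <= d x w' -> d w w' + d x w <= d x w' + 18.
    by move=> h1 h2 h3 h4; have := four_point w w' x c; dlia.
  have yr := dT y x xr; have yl := dT y x xl.
  have notsame c : d x c = L -> d xl c + d x xl <= L + 12 ->
      d xr c + d x xr <= L + 12 -> False.
    move=> h1 h2 h3; case: (leqP (d x xl) (d x xr)) => [le|/ltnW le].
      by have := same c xl xr h1 h2 h3 le; dlia.
    by have := same c xr xl h1 h3 h2 le; dlia.
  have ba : d b a = 2 * L by rewrite dC.
  have main c c' : d x c = L -> d x c' = L -> d c c' = 2 * L ->
      d xl c + d x xl <= L + 12 -> d xr c' + d x xr <= L + 12 ->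
      (d y c + d x y <= L + 12 \/ d y c' + d x y <= L + 12) ->
      d y xl + d y xr <= d xl xr + 42.
    move=> h1 h2 h3 h4 h5 h6; have := opp _ _ _ _ h1 h3 h4 h5; case: h6 => h6.
      by have := same c y xl h1 h6 h4 ltac:(lia); dlia.
    by have := same c' y xr h2 h6 h5 ltac:(lia); dlia.
  case: onl => onl; case: onr => onr.
  - by case: (notsame a).
  - exact: (main a b).
  - by apply: (main b a) => //; case: ony; auto.
  - by case: (notsame b).
clear onl onr ony XA XL XR Y exl1 exl2 exr1 exr2 exy xa xb ab xt.
have yl : 2 * W <= d y xl + 0.
  by have := dT ql xl (p t); have := dT xl y (p t); dlia.
have yr : 2 * W <= d y xr + 0.
  by have := dT qr xr (p t); have := dT xr y (p t); dlia.
have g1 : d y ql + d y xr <= d ql xr + 48.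
  by have := dT y ql xl; have := four_point y ql xl xr; dlia.
have g2 : d y ql + d y qr <= d ql qr + 54.
  by have := dT y qr xr; have := four_point y qr xr ql; dlia.
have yql : d y ql <= 10 * W by have := dT y (p t) ql; dlia.
(* The point of the geodesic as far from [ql] as [y] is. *)
pose t' := t - 5 * W + d y ql.
have l1 : d ql (p t') = d y ql by rewrite gp /t'; lia.
have l2 : d (p t') qr = 10 * W - d y ql by rewrite gp /t'; lia.
exists t'; first by rewrite /t'; lia.
by have := four_point y (p t') ql qr; dlia.
Qed.

(** Away from the ends a candidate is close to the geodesic, hence within [W] of a member of [X],
    and so is no ruler. A hop shifts its projection by less than [3 * W], so [l] hops do not reach
    the ends. *)
Lemma hops_escape l y t : candidate y -> d y (p t) <= 2 * W -> hops l y ->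
  3 * W * l.+1 + 7 * W <= t -> t + 3 * W * l.+1 + 7 * W <= d u v -> False.
Proof.
elim: l y t => [|l IH] y t cy yt hy t1 t2.
all: have [t' t'n yt'] := candidate_near_line cy yt ltac:(lia) ltac:(lia).
all: have [x Xx xt'] := chain_dense t'n.
all: have far r : ruler r -> W < d x r by exact: X_far.
all: have tt' : t <= t' + 2 * W + 60 /\ t' <= t + 2 * W + 60 by
  have := dT (p t) y (p t'); case: (leqP t t') => le;
  [rewrite (gp le t'n)|rewrite (dC (p t)) (gp (ltnW le))]; dlia.
all: case: hy => [/far|].
1,3: by have := dT x (p t') y; dlia.
- by [].
move=> [y' [cy' yy' hy']]; apply: (IH y' t') => //; try lia.
by have := dT y' y (p t'); dlia.
Qed.
End Component.

Lemma chain_diameter u v : X u -> reach (fun x y => d x y <= W /\ X y) u v ->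
  d u v <= (6 * k + 24) * W.
Proof.
move=> uX uv; rewrite leqNgt; apply/negP => far.
have [p [p0 pn gp]] := geo u v; have uv0 : 0 < d u v by lia.
pose t := (d u v)./2; have tE : 2 * t <= d u v <= 2 * t + 1 by rewrite /t; lia.
have [x Xx xt] := chain_dense uX uv uv0 p0 pn gp (t := t) ltac:(lia).
apply: (hops_escape uX uv uv0 p0 pn gp (X_cand Xx) (t := t) _ (cand_hops (X_cand Xx))).
all: lia.
Qed.
End Hyperbolic.

(** * Extending colours prescribed on distant cliques *)

Lemma inject_into (K M : finType) (f : K -> M) (O : {set K}) (F : {set M}) :
  #|O| <= #|F| ->
  exists g : K -> M, {in O &, injective g} /\ {in O, forall c, g c \in F}.
Proof.
(* An empty [F] forces [O] to be empty, and [f] then serves as an arbitrary function. *)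
move=> le; case: (set_0Vmem F) => [F0|[y0 _]].
  exists f; move: le; rewrite F0 cards0 leqn0 cards_eq0 => /eqP ->.
  by split=> c; rewrite inE.
have idx c : c \in O -> index c (enum O) < size (enum F).
  by move=> cO; rewrite -cardE (leq_trans _ le) // [#|O|]cardE index_mem mem_enum.
exists (fun c => nth y0 (enum F) (index c (enum O))); split=> [c c' cO c'O /eqP|c cO].
  rewrite nth_uniq ?enum_uniq ?idx // => /eqP e.
  by rewrite -(nth_index c (s := enum O) (x := c)) ?mem_enum // e nth_index ?mem_enum.
by rewrite -mem_enum mem_nth ?idx.
Qed.

(** Maps from old to new colours that may be applied at the two ends of an edge, whose old colours
    differ. *)
Definition compatible (K M : eqType) (f g : K -> M) := forall a b, a <> b -> f a <> g b.

Lemma swap_block (k n q : nat) (f t : 'I_k -> 'I_n) (B : {set 'I_k}) :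
  k + q <= n -> compatible f f -> {in B &, injective t} -> #|B| <= q ->
  exists f1 f2, [/\ compatible f1 f1, compatible f2 f2, compatible f f1,
      compatible f1 f2 & [/\ {in B, forall c, f2 c = t c}
    & forall c, c \notin B -> f c \notin t @: B -> f2 c = f c]].
Proof.
move=> kn ff tI Bq.
have fI : injective f.
  by move=> a b e; apply: contrapT => /ff; rewrite e.
pose O := [set c | f c \in t @: B]; pose F := ~: (f @: setT :|: t @: B).
have OF : #|O| <= #|F|.
  have fO : f @: O = f @: setT :&: t @: B.
    apply/setP => y; rewrite inE; apply/imsetP/andP => [[c]|[/imsetP[c _ ->]]].
      by rewrite inE => ct ->; rewrite imset_f.
    by move=> ct; exists c; rewrite ?inE.
  have := cardsC (f @: setT :|: t @: B); rewrite cardsU -fO !(card_imset _ fI) (card_in_imset tI).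
  rewrite cardsT !card_ord -/F => e.
  have := max_card (mem O); rewrite card_ord.
  by move: e kn Bq; set a := #|O|; set b := #|B|; set c := #|F|; lia.
have [g [gI gF]] := inject_into f OF.
have gF1 c x : c \in O -> g c <> f x.
  by move=> /gF; rewrite !inE negb_or => /andP[/negP n1 _] e; apply: n1; rewrite e imset_f.
have gF2 c x : c \in O -> x \in B -> g c <> t x.
  by move=> /gF; rewrite !inE negb_or => /andP[_ /negP n1] xB e; apply: n1; rewrite e imset_f.
pose f1 c := if c \in O then g c else f c.
pose f2 c := if c \in B then t c else f1 c.
have f1t c x : x \in B -> f1 c <> t x.
  move=> xB; rewrite /f1; case: ifPn => [cO|]; first exact: gF2.
  by rewrite inE => /negP nt e; apply: nt; rewrite e imset_f.
have c1 : compatible f1 f1.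
  move=> a b ab; rewrite /f1; case: ifPn => aO; case: ifPn => bO.
  - by move=> /gI; auto.
  - exact: gF1.
  - by move=> e; apply: (gF1 b a).
  - exact: ff.
exists f1, f2; split=> //.
- move=> a b ab; rewrite /f2; case: ifPn => aB; case: ifPn => bB.
  + by move=> /tI; auto.
  + by move=> e; apply: (f1t b a).
  + exact: f1t.
  + exact: c1.
- move=> a b ab; rewrite /f1; case: ifPn => bO; last exact: ff.
  by move=> e; apply: (gF1 b a).
- by move=> a b ab; rewrite /f2; case: ifPn => bB; [exact: f1t|exact: c1].
split=> c cB; first by rewrite /f2 cB.
by move=> ct; rewrite /f2 (negbTE cB) /f1 inE (negbTE ct).
Qed.

(* Two steps free the targets of a block of [q] colours and then fill them. *)
Lemma recolor_path (k q m : nat) (A : {set 'I_k}) (t : 'I_k -> 'I_(k + q)) :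
  k <= m * q -> {in A &, injective t} ->
  exists P : nat -> 'I_k -> 'I_(k + q),
  [/\ P 0 =1 widen_ord (leq_addr q k), forall i, i <= 2 * m -> compatible (P i) (P i),
      forall i, i < 2 * m -> compatible (P i) (P i.+1)
    & {in A, forall c, P (2 * m) c = t c}].
Proof.
move=> kmq tI.
suff main j : exists P : nat -> 'I_k -> 'I_(k + q),
  [/\ P 0 =1 widen_ord (leq_addr q k), forall i, i <= 2 * j -> compatible (P i) (P i),
      forall i, i < 2 * j -> compatible (P i) (P i.+1)
    & {in A, forall c : 'I_k, c < j * q -> P (2 * j) c = t c}].
  have [P [P0 P1 P2 P3]] := main m; exists P; split=> // c cA.
  by apply: P3 => //; apply: leq_trans kmq.
elim: j => [|j [P [P0 P1 P2 P3]]].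
  exists (fun=> widen_ord (leq_addr q k)); split; [by []| |by move=> i; rewrite muln0|].
    by move=> i _ a b ab /(congr1 val) /= /val_inj.
  by move=> c _; rewrite mul0n.
pose B := [set c in A | j * q <= c < j.+1 * q].
have BI : {in B &, injective t}.
  by move=> c c'; rewrite !inE => /andP[cA _] /andP[c'A _]; apply: tI.
have Bq : #|B| <= q.
  rewrite cardE -(size_map val) -[leqRHS](size_iota (j * q)).
  apply: uniq_leq_size; first by rewrite map_inj_uniq ?enum_uniq //; apply: val_inj.
  move=> x /mapP[c]; rewrite mem_enum !inE => /and3P[_ c1 c2] ->.
  by rewrite mem_iota c1 /= addnC -mulSn.
have [f1 [f2 [c1 c2 c01 c12 [f2B f2n]]]] :=
  swap_block (leqnn _) (P1 _ (leqnn _)) BI Bq.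
exists (fun i => if i <= 2 * j then P i else if i == (2 * j).+1 then f1 else f2).
rewrite (_ : 2 * j.+1 = (2 * j).+2); last by lia.
have e1 : ((2 * j).+1 <= 2 * j) = false by lia.
have e2 : ((2 * j).+2 <= 2 * j) = false by lia.
have e3 : ((2 * j).+2 == (2 * j).+1) = false by lia.
split=> // [i ile|i ilt|c cA cj].
- by case: leqP => // [le|lt]; [apply: P1|case: eqP].
- have [->|n1] := eqVneq i (2 * j).+1; first by rewrite e1 e2 e3 ?eqxx.
  have [->|n2] := eqVneq i (2 * j); first by rewrite leqnn e1 ?eqxx.
  have lt : i < 2 * j by lia.
  by rewrite (ltnW lt) lt; apply: P2.
rewrite e2 e3; have [cB|cB] := boolP (c \in B); first exact: f2B.
have cjq : c < j * q by move: cB; rewrite inE cA cj andbT -ltnNge.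
(* A colour of an earlier block already sits on its own target, which by injectivity on [A] is no
   target of [B]. *)
rewrite f2n ?P3 //; apply/imsetP => -[x]; rewrite inE => /and3P[xA x1 _] /tI e.
by move: x1; rewrite -e // leqNgt cjq.
Qed.

Section Extension.
Variables (E : rel nat) (k q m : nat) (f0 : nat -> nat).
Hypothesis ES : symmetric E.
Hypothesis f0E : forall x y, E x y -> f0 x <> f0 y.
Hypothesis f0k : forall x, f0 x < k.
Hypothesis kmq : k <= m * q.
Variables (S : nat -> Prop) (K : nat -> nat -> Prop) (c : nat -> nat -> nat).
Hypothesis Ssep : forall s s', S s -> S s' -> near E (4 * m + 5) s s' -> s = s'.
Hypothesis Knear : forall s x, S s -> K s x -> near E 1 s x.
Hypothesis Kadj : forall s x y, S s -> K s x -> K s y -> x = y \/ E x y.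
Hypothesis cinj : forall s x y, S s -> K s x -> K s y -> c s x = c s y -> x = y.
Hypothesis ck : forall s x, S s -> K s x -> c s x < k.

(** A vertex at distance [i] from [s] applies stage [2 * m - (i - 1)] of the recolouring path of
    [s]: the last on the clique, stage 0 at distance [2 * m + 1]. Adjacent vertices differ by at
    most one stage. Edges join no neighbourhoods of distinct centres, by [Ssep]. *)
Lemma extend_coloring : exists g : nat -> nat,
  [/\ forall x y, E x y -> g x <> g y, forall x, g x < k + q
    & forall s x, S s -> K s x -> g x = c s x].
Proof.
case: k f0k kmq ck => [|k0] f0k' kmq' ck'; first by have := f0k' 0.
set k1 := k0.+1 in f0k' kmq' ck'.
have f0K s x y : S s -> K s x -> K s y -> f0 x = f0 y -> x = y.
  by move=> Ss Kx Ky e; have [//|/f0E] := Kadj Ss Kx Ky.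
have paths s : exists P : nat -> 'I_k1 -> 'I_(k1 + q), S s ->
  [/\ P 0 =1 widen_ord (leq_addr q k1), forall i, i <= 2 * m -> compatible (P i) (P i),
      forall i, i < 2 * m -> compatible (P i) (P i.+1)
    & forall x, K s x -> P (2 * m) (inord (f0 x)) = c s x :> nat].
  have [Ss|nS] := pselect (S s); last by exists (fun _ => widen_ord (leq_addr q k1)).
  (* [A] holds the old colours on the clique; each occurs on one vertex only, [rep a], whose
     prescribed colour is the target. *)
  pose A : {set 'I_k1} := [set a : 'I_k1 | `[< exists2 x, K s x & f0 x = a >]].
  pose rep (a : 'I_k1) := pick_or 0 (fun x => K s x /\ f0 x = a).
  have repP a : a \in A -> K s (rep a) /\ f0 (rep a) = a.
    rewrite inE => /asboolP[x Kx xa].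
    by apply: (@pick_orP _ _ (fun x => K s x /\ f0 x = a)); exists x.
  pose t (a : 'I_k1) := widen_ord (leq_addr q k1) (inord (c s (rep a))).
  have tI : {in A &, injective t}.
    move=> a b /repP[Ka fa] /repP[Kb fb] /(congr1 val) /=.
    rewrite !inordK; try exact: ck'.
    by move=> /(cinj Ss Ka Kb) e; apply: val_inj; rewrite /= -fa -fb e.
  have [P [P0 P1 P2 P3]] := recolor_path kmq' tI; exists P => _; split=> // x Kx.
  have xA : inord (f0 x) \in A.
    by rewrite inE; apply/asboolP; exists x => //; rewrite inordK //; apply: f0k'.
  have [Kr fr] := repP _ xA; rewrite P3 //= inordK; last exact: ck'.
  by congr c; apply: (f0K s) => //; rewrite fr inordK //; apply: f0k'.
have {paths} [P PP] := choice paths.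
pose near_cut x s := S s /\ near E (2 * m + 1) s x.
(* The truncated predecessor gives distances 0 and 1 the same final stage. *)
pose gv s x := P s (2 * m - (dist E s x).-1) (inord (f0 x)) : nat.
pose g x := if pselect (exists s, near_cut x s) is left h then gv (projT1 (cid h)) x else f0 x.
have gS x s : near_cut x s -> g x = gv s x.
  move=> [Ss sx]; rewrite /g; case: pselect => [h|[]]; last by exists s.
  case: cid => s' [Ss' s'x] /=; congr gv; apply: Ssep => //.
  by apply: near_mono (near_trans s'x (near_sym ES sx)); lia.
have gN x : ~ (exists s, near_cut x s) -> g x = f0 x by rewrite /g; case: pselect.
have f0I x y : E x y -> (inord (f0 x) : 'I_k1) <> inord (f0 y).
  by move=> xy /(congr1 val) /=; rewrite !inordK; try exact: f0k'; apply: f0E.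
exists g; split.
- move=> x y xy.
  (* A vertex with a neighbour outside all neighbourhoods is at distance exactly [2 * m + 1], where
     the original colour is still in use. *)
  have half u v s : E u v -> near_cut u s -> ~ (exists s, near_cut v s) -> g u <> g v.
    move=> uv us nv; rewrite (gS _ _ us) (gN _ nv) /gv.
    have [Ss su] := us; have csu : conn E s u by exists (2 * m + 1).
    have dsu : dist E s u = 2 * m + 1.
      have := dist_le su; have [le|lt _] := leqP (2 * m + 1) (dist E s u); first by lia.
      case: nv; exists s; split=> //; apply: near_mono (near_step (near_dist csu) uv); lia.
    rewrite dsu; have -> : 2 * m - (2 * m + 1).-1 = 0 by lia.
    have [P0 _ _ _] := PP s Ss; rewrite P0 /= inordK; last exact: f0k'.
    exact: f0E.
  have [[s xs]|nx] := pselect (exists s, near_cut x s); last first.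
    have [[s ys]|ny] := pselect (exists s, near_cut y s); last by rewrite !gN //; apply: f0E.
    by move=> e; apply: (half y x s) => //; rewrite ES.
  have [[s' ys']|ny] := pselect (exists s, near_cut y s); last exact: (half x y s).
  have ss' : s = s'.
    apply: Ssep; [exact: xs.1|exact: ys'.1|].
    apply: near_mono (near_trans (near_step xs.2 xy) (near_sym ES ys'.2)); lia.
  rewrite -ss' in ys'; rewrite (gS _ _ xs) (gS _ _ ys') /gv => /val_inj.
  have [Ss sx] := xs; have csx : conn E s x by exists (2 * m + 1).
  have := dist_edge csx xy; have := dist_edge_ge ES csx xy.
  have := dist_le sx; have := dist_le ys'.2.
  set i := 2 * m - (dist E s x).-1; set j := 2 * m - (dist E s y).-1 => h1 h2 h3 h4.
  have [_ P1 P2 _] := PP s Ss.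
  have [ij|[ij|ij]] : i = j \/ i.+1 = j \/ j.+1 = i by rewrite /i /j; lia.
  + by rewrite ij; apply: P1; [rewrite /j; lia|apply: f0I].
  + by rewrite -ij; apply: P2; [rewrite /i /j in ij *; lia|apply: f0I].
  + move=> e; apply: (P2 j) (esym _); last by rewrite ij; exact: e.
      by rewrite /i /j in ij *; lia.
    by move=> e'; apply: (f0I x y).
- move=> x; rewrite /g; case: pselect => [h|_]; first exact: ltn_ord.
  by apply: leq_trans (f0k' x) (leq_addr _ _).
move=> s x Ss Kx; have sx := Knear Ss Kx.
rewrite (gS _ s); last by split=> //; apply: near_mono sx; lia.
rewrite /gv (_ : _ - _ = 2 * m); last by have := dist_le sx; lia.
by have [_ _ _ ->] := PP s Ss.
Qed.
End Extension.

(** * The colouring and its locality *)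

Section Construction.
Variables (W : nat) (E : rel nat).

(** The abstract levels for [R = 14 * W], [L0 = 15 * W], [L1 = 43 * W]; positive lower bounds on the
    legs keep junk distances out. *)
Fixpoint level (i x : nat) : Prop :=
  if i is j.+1 then exists y, near E (14 * W) x y /\ exists a1 a2 a3,
    [/\ level j a1 /\ 15 * W <= dist E y a1 <= 43 * W,
        level j a2 /\ 15 * W <= dist E y a2 <= 43 * W
      & level j a3 /\ 15 * W <= dist E y a3 <= 43 * W] /\
    [/\ dist E y a1 + dist E y a2 <= dist E a1 a2 + 12,
        dist E y a1 + dist E y a3 <= dist E a1 a3 + 12
      & dist E y a2 + dist E y a3 <= dist E a2 a3 + 12]
  else True.

Definition armed_at i x a b :=
  [/\ level i x, ~ level i.+1 x, level i a, level i b
    & [/\ dist E x a = 29 * W, dist E x b = 29 * W & dist E a b = 58 * W]].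

Definition has_arms x a b := exists i, armed_at i x a b.

Definition cand x := exists a b, has_arms x a b.

(* Ruling set by bits of the identifiers: at round [j] a vertex whose bit [j] is
   set is removed by a close survivor sharing its higher bits. *)
Fixpoint alive (j x : nat) : Prop :=
  if j is i.+1 then alive i x /\ ~ (odd (x %/ 2 ^ i) /\ exists y,
    [/\ alive i y, near E W x y, y %/ 2 ^ i.+1 = x %/ 2 ^ i.+1 & ~~ odd (y %/ 2 ^ i)])
  else cand x.

Definition ruling x := forall j, alive j x.

Definition free x := cand x /\ forall r, ruling r -> ~ near E W x r.

Definition linked := reach (fun x y => near E W x y /\ free y).

Definition packing x (M : nat -> Prop) :=
  [/\ forall y, M y -> linked x y, forall y z, M y -> M z -> near E W y z -> y = z
    & forall y, linked x y -> exists2 z, M z & near E W y z].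

(** Linked free vertices have the same predicate [packing], so a whole chain shares one family. *)
Definition filler x : nat -> Prop := pick_or (fun=> False) (packing x).

Definition selected x := ruling x \/ (free x /\ filler x x).

Definition arms s : nat * nat := pick_or (0, 0) (fun ab => has_arms s ab.1 ab.2).

Definition cut s := cutset E (29 * W) s (arms s).1 (arms s).2.

(** A cut clique is coloured by rank in the order of identifiers, a rule that any node seeing the
    clique can apply. *)
Definition cut_rank s x := count (fun y => `[< cut s y >]) (iota 0 x).

Definition on_cut x := exists2 s, selected s & cut s x.

Definition cut_color x c := exists s, [/\ selected s, cut s x & c = cut_rank s x].

Definition piece := reach (fun x y => [/\ E x y, ~ on_cut x & ~ on_cut y]).

Definition extends v M (f : nat -> nat) :=
  (forall x, piece v x -> f x < M) /\
  (forall x y, piece v x -> E x y ->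
     (piece v y -> f x <> f y) /\ (forall c, cut_color y c -> f x <> c)).

(** Minimising lets a piece be coloured without knowledge of the chromatic number; a global
    extension bounds the minimum later. *)
Definition optimal v (Mf : nat * (nat -> nat)) :=
  extends v Mf.1 Mf.2 /\ forall M f, extends v M f -> Mf.1 <= M.

Definition color v : nat :=
  if pselect (on_cut v) then pick_or 0 (cut_color v)
  else (pick_or (0, fun=> 0) (optimal v)).2 v.

Lemma level_anti i j x : i <= j -> level j x -> level i x.
Proof.
have step k : forall y, level k.+1 y -> level k y.
  elim: k => [//|k IH] y [z [yz [a1 [a2 [a3 [[A1 A2 A3] s]]]]]].
  exists z; split=> //; exists a1, a2, a3; split=> //.
  by split; [move: A1|move: A2|move: A3] => -[/IH la b].
move=> /subnK <-; elim: (j - i) => // k IH; rewrite addSn => /step; exact: IH.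
Qed.

Lemma alive_anti i j x : i <= j -> alive j x -> alive i x.
Proof. by move=> /subnK <-; elim: (j - i) => // k IH; rewrite addSn => -[/IH]. Qed.

(** Identifiers below [2 ^ N] have no bit set from position [N] on, so later rounds remove none of
    them. *)
Lemma ruling_alive N x : x < 2 ^ N -> ruling x <-> alive N x.
Proof.
move=> xN; split=> [//|aN] j; have [le|/ltnW le] := leqP j N; first exact: alive_anti aN.
rewrite -(subnK le); elim: (j - N) => // k IH; rewrite addSn; split=> // -[].
rewrite divn_small // (leq_trans xN) // leq_exp2l //; lia.
Qed.

Lemma selected_cand x : selected x -> cand x.
Proof. by case=> [/(_ 0)|[[]]]. Qed.

Lemma armsP s : cand s -> has_arms s (arms s).1 (arms s).2.
Proof.
move=> [a [b ab]]; apply: (@pick_orP _ _ (fun ab => has_arms s ab.1 ab.2)).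
by exists (a, b).
Qed.
End Construction.

(** * What a vertex can determine from its neighbourhood *)

Lemma reach_iff (T : Type) (r r' : T -> T -> Prop) x :
  (forall u v, reach r x u -> r u v <-> r' u v) ->
  forall y, reach r x y <-> reach r' x y.
Proof.
move=> rr' y; split; first by apply: reach_sub => u v xu /(rr' _ _ xu).
by elim=> [|u v _ xu uv]; [exact: reach_refl|apply: (reach_step xu); apply/rr'].
Qed.

(** Entire rows agree, including edges leaving the ball: this is what [T] rounds of gathering
    reveal. *)
Definition agree (E E' : rel nat) o T := forall x, near E T o x -> E x =1 E' x.

Section Agree.
Variables (E E' : rel nat) (o T : nat).
Hypothesis ag : agree E E' o T.

Lemma near_loc r s x y : near E r o x -> r + s <= T -> near E s x y <-> near E' s x y.
Proof.
move=> ox; elim: s y => // s IH y rs; have {}IH z := IH z ltac:(lia).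
split=> -[/IH|[z xz zy]]; first by left.
- right; exists z; first exact/IH.
  by rewrite -ag //; apply: near_mono (near_trans ox xz); lia.
- by left.
move/IH in xz; right; exists z => //.
by rewrite ag //; apply: near_mono (near_trans ox xz); lia.
Qed.

Lemma agree_sym : agree E' E o T.
Proof. by move=> x /(near_loc _ (near0 E 0 o) (leqnn _)) ox y; rewrite ag. Qed.

Lemma dist_loc r s x y : near E r o x -> r + s <= T -> near E s x y ->
  dist E x y = dist E' x y.
Proof.
move=> ox rs xy; have nl t : t <= s -> near E t x y <-> near E' t x y.
  by move=> ts; apply: near_loc ox _; lia.
have xy' := (nl _ (leqnn _)).1 xy.
apply/eqP; rewrite eqn_leq; apply/andP; split; apply: dist_le.
- by apply/nl; [exact: dist_le xy'|apply: near_dist; exists s].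
- by apply/nl; [exact: dist_le xy|apply: near_dist; exists s].
Qed.

End Agree.

Lemma near_of_dist E x y k : 0 < k -> k <= dist E x y -> near E (dist E x y) x y.
Proof. by move=> k0 le; apply: near_dist; apply: dist_ge_conn le. Qed.

Section LevelLocality.
Variables (W o T : nat).
Hypothesis W0 : 0 < W.

(** One inclusion is enough, [agree] being symmetric. Leg ends are within [14 * W + 43 * W], so
    [200 * W] per level is ample. *)
Lemma level_loc1 E E' : symmetric E -> agree E E' o T -> forall i r x,
  near E r o x -> r + i * (200 * W) <= T -> level W E i x -> level W E' i x.
Proof.
move=> ES ag; elim=> // i IH r x ox rT [y [xy [a1 [a2 [a3 [A S]]]]]].
exists y; split; first by apply: (proj1 (near_loc ag _ ox _) xy); lia.
have oy := near_trans ox xy; exists a1, a2, a3.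
have ya a : 15 * W <= dist E y a <= 43 * W -> near E (43 * W) y a.
  move=> /andP[h1 h2]; apply: near_mono h2 _; apply: near_of_dist h1; lia.
have dya a : 15 * W <= dist E y a <= 43 * W -> dist E' y a = dist E y a.
  by move=> /ya n; rewrite (dist_loc ag oy _ n) //; lia.
have daa a b : 15 * W <= dist E y a <= 43 * W -> 15 * W <= dist E y b <= 43 * W ->
    dist E' a b = dist E a b.
  move=> /ya na /ya nb; have oa := near_trans oy na.
  by rewrite (dist_loc ag oa _ (near_trans (near_sym ES na) nb)) //; lia.
have la a : 15 * W <= dist E y a <= 43 * W -> level W E i a -> level W E' i a.
  by move=> /ya na; apply: (IH _ _ (near_trans oy na)); lia.
move: A S => [[l1 d1] [l2 d2] [l3 d3]].
rewrite (dya _ d1) (dya _ d2) (dya _ d3) (daa _ _ d1 d2) (daa _ _ d1 d3) (daa _ _ d2 d3).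
by split=> //; split; split=> //; apply: la.
Qed.

Lemma armed_loc1 E E' : symmetric E -> symmetric E' -> agree E E' o T -> forall i r x a b,
  near E r o x -> r + i.+2 * (200 * W) <= T -> armed_at W E i x a b -> armed_at W E' i x a b.
Proof.
move=> ES ES' ag i r x a b ox rT [lx nlx la lb [xa xb ab]].
have na : near E (29 * W) x a by rewrite -xa; apply: (@near_of_dist _ _ _ 1); lia.
have nb : near E (29 * W) x b by rewrite -xb; apply: (@near_of_dist _ _ _ 1); lia.
have nab : near E (58 * W) a b by rewrite -ab; apply: (@near_of_dist _ _ _ 1); lia.
have oa := near_trans ox na; have ob := near_trans ox nb.
split.
- by apply: (level_loc1 ES ag ox) lx; lia.
- move=> l; apply: nlx; have ox' : near E' r o x.
    by apply: (proj1 (near_loc ag _ (near0 E 0 o) _) ox); lia.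
  by apply: (level_loc1 ES' (agree_sym ag) ox') l; lia.
- by apply: (level_loc1 ES ag oa) la; lia.
- by apply: (level_loc1 ES ag ob) lb; lia.
by rewrite -(dist_loc ag ox _ na) -1?(dist_loc ag ox _ nb) -1?(dist_loc ag oa _ nab) //; lia.
Qed.
End LevelLocality.

Section Locality.
Variables (W o T K N DX DP : nat) (E E' : rel nat).
Hypothesis W0 : 0 < W.
Hypothesis ES : symmetric E.
Hypothesis ES' : symmetric E'.
Hypothesis ag : agree E E' o T.
Hypothesis levelK : forall x, conn E o x -> ~ level W E K x.
Hypothesis idN : forall x, conn E o x -> x < 2 ^ N.
Hypothesis linkedD : forall x y, conn E o x -> free W E x -> linked W E x y -> near E DX x y.
Hypothesis pieceD : forall x y, conn E o x -> piece W E x y -> near E DP x y.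

Let ag' := agree_sym ag.

(** Radii that decide candidacy, the ruling set, selection and the cut cliques, in this order. *)
Let rC := K.+3 * (200 * W).
Let rR := rC + N * W.
Let rS := rR + DX + 3 * W.
Let rI := rS + 200 * W.

Lemma near_o r x : r <= T -> near E r o x <-> near E' r o x.
Proof. by move=> le; apply: (near_loc ag _ (near0 E 0 o)); lia. Qed.

(** [levelK] speaks of [E]; a level reaching [K] in [E'] would transfer back to [E]. *)
Lemma has_arms_loc r x a b : near E r o x -> r + rC <= T ->
  has_arms W E x a b <-> has_arms W E' x a b.
Proof.
move=> ox rT; have ox' : near E' r o x by apply: (proj1 (near_o _ _) ox); lia.
have cx : conn E o x by exists r.
have small i : i < K -> r + i.+2 * (200 * W) <= T.
  by move=> iK; apply: leq_trans rT; rewrite leq_add2l leq_mul2r; lia.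
split=> -[i A]; exists i.
- apply: (armed_loc1 W0 ES ES' ag ox _ A); apply: small.
  by rewrite ltnNge; apply/negP => /level_anti le; case: A => /le /(levelK cx).
- apply: (armed_loc1 W0 ES' ES ag' ox' _ A); apply: small.
  rewrite ltnNge; apply/negP => /level_anti le; case: A => /le l _ _ _ _.
  apply: (levelK cx); apply: (level_loc1 W0 ES' ag' ox') l.
  by apply: leq_trans rT; rewrite leq_add2l leq_mul2r; lia.
Qed.

Lemma cand_loc r x : near E r o x -> r + rC <= T -> cand W E x <-> cand W E' x.
Proof.
by move=> ox rT; split=> -[a [b /(has_arms_loc _ _ ox rT) A]]; exists a, b.
Qed.

Lemma alive_loc j r x : near E r o x -> r + rC + j * W <= T ->
  alive W E j x <-> alive W E' j x.
Proof.
elim: j r x => [|j IH] r x ox rT; first by apply: cand_loc ox _; lia.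
have rT' : r + rC + j * W <= T by lia.
have nW y : near E W x y <-> near E' W x y by apply: (near_loc ag _ ox); lia.
have aW y : near E W x y -> alive W E j y <-> alive W E' j y.
  by move=> xy; apply: (IH _ _ (near_trans ox xy)); lia.
split=> -[/(IH _ _ ox rT') ax nk]; split=> // -[od [y [ay xy yx ev]]]; apply: nk; split=> //.
- by move/nW in xy; exists y; split=> //; apply/aW.
- by exists y; split=> //; [apply/(aW _ xy)|apply/nW].
Qed.

Lemma ruling_loc r x : near E r o x -> r + rR <= T -> ruling W E x <-> ruling W E' x.
Proof.
move=> ox rT; have xN : x < 2 ^ N by apply: idN; exists r.
rewrite (ruling_alive _ _ xN) (ruling_alive _ _ xN).
by apply: alive_loc ox _; rewrite -addnA.
Qed.

Lemma free_loc r x : near E r o x -> r + rR + W <= T -> free W E x <-> free W E' x.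
Proof.
move=> ox rT; have nW y : near E W x y <-> near E' W x y by apply: (near_loc ag _ ox); lia.
have rW y : near E W x y -> ruling W E y <-> ruling W E' y.
  by move=> xy; apply: (ruling_loc (near_trans ox xy)); lia.
have rT' : r + rC <= T by rewrite /rR in rT; lia.
split=> -[/(cand_loc ox rT') cx far]; split=> // y ry xy; apply: (far y) => //.
- by move/nW in xy; apply/(rW _ xy).
- by apply/nW.
- by apply/(rW _ xy).
- by apply/nW.
Qed.

(** [reach_iff] compares the relations along walks of [E], which the diameter bound keeps within
    sight. *)
Lemma linked_loc r x y : near E r o x -> r + rS <= T -> free W E x ->
  linked W E x y <-> linked W E' x y.
Proof.
move=> ox rT fx; apply: reach_iff => u v xu.
have ou : near E (r + DX) o u by exact: near_trans ox (linkedD (near_conn ox) fx xu).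
have nW : near E W u v <-> near E' W u v by apply: (near_loc ag _ ou); rewrite /rS in rT; lia.
have fW : near E W u v -> free W E v <-> free W E' v.
  by move=> uv; apply: (free_loc (near_trans ou uv)); rewrite /rS in rT; lia.
split=> -[uv fv]; first by split; [exact/nW|apply/(fW uv)].
by move/nW in uv; split=> //; apply/(fW uv).
Qed.

Lemma filler_loc r x : near E r o x -> r + rS <= T -> free W E x ->
  filler W E x = filler W E' x.
Proof.
move=> ox rT fx; congr pick_or; apply/funext => M; apply/propext.
have lk y := linked_loc y ox rT fx.
have nW y z : linked W E x y -> near E W y z <-> near E' W y z.
  move=> xy; have ou : near E (r + DX) o y by exact: near_trans ox (linkedD (near_conn ox) fx xy).
  by apply: (near_loc ag _ ou); rewrite /rS in rT; lia.
split=> -[M1 M2 M3]; split.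
- by move=> y /M1 /lk.
- by move=> y z My Mz /(nW _ _ (M1 _ My)); apply: M2.
- by move=> y /lk xy; have [z Mz yz] := M3 _ xy; exists z => //; apply/nW.
- by move=> y /M1 /lk.
- by move=> y z My Mz /(nW _ _ ((lk _).2 (M1 _ My))); apply: M2.
- by move=> y xy; have /lk/M3[z Mz yz] := xy; exists z => //; apply/nW.
Qed.

Lemma selected_loc r x : near E r o x -> r + rS <= T -> selected W E x <-> selected W E' x.
Proof.
move=> ox rT; have rT1 : r + rR <= T by rewrite /rS in rT; lia.
have fl : free W E x <-> free W E' x by apply: (free_loc ox); rewrite /rS in rT; lia.
split=> -[/(ruling_loc ox rT1) rx|[fx sx]]; try by left.
- by right; split; [exact/fl|rewrite -(filler_loc ox)].
- by move/fl in fx; right; split=> //; rewrite (filler_loc ox).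
Qed.

Lemma arms_loc r s : near E r o s -> r + rC <= T -> arms W E s = arms W E' s.
Proof.
move=> os rT; congr pick_or; apply/funext => -[a b]; apply/propext => /=.
exact: has_arms_loc os rT.
Qed.

Lemma cut_loc r s x : near E r o s -> r + rI <= T -> cand W E s ->
  cut W E s x <-> cut W E' s x.
Proof.
move=> os rT cs; have rT1 : r + rC <= T by rewrite /rI /rS /rR in rT; lia.
have rT2 : r + 200 * W <= T by rewrite /rI in rT; lia.
rewrite /cut -(arms_loc os rT1); have := armsP cs.
move: (arms W E s) => [a b] /= [i [_ _ _ _ [sa sb ab]]].
have na : near E (29 * W) s a by rewrite -sa; apply: (@near_of_dist _ _ _ 1); lia.
have nab : near E (58 * W) a b by rewrite -ab; apply: (@near_of_dist _ _ _ 1); lia.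
have oa := near_trans os na.
have da y : near E (58 * W).+1 a y -> dist E a y = dist E' a y.
  by move=> ay; apply: (dist_loc ag oa _ ay); lia.
have n1 : near E 1 s x <-> near E' 1 s x by apply: (near_loc ag _ os); lia.
have shell y : reach (fun u v => E u v /\ 29 * W < dist E a v <= 2 * (29 * W)) b y <->
    reach (fun u v => E' u v /\ 29 * W < dist E' a v <= 2 * (29 * W)) b y.
  apply: reach_iff => u v bu.
  have au : near E (58 * W) a u.
    case: bu => // w z _ [_ /andP[h1 h2]].
    by apply: near_mono (near_of_dist _ h1); lia.
  have Eu : E u =1 E' u by apply: ag; apply: near_mono (near_trans oa au); lia.
  rewrite -Eu; split=> -[uv h]; split=> //; have := near_step au uv; move=> /da dv.
    by rewrite -dv.
  by rewrite dv.
have ax : near E 1 s x -> dist E a x = dist E' a x.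
  by move=> sx; apply: da; apply: near_mono (near_trans (near_sym ES na) sx); lia.
have Ex : near E 1 s x -> E x =1 E' x.
  by move=> sx; apply: ag; apply: near_mono (near_trans os sx); lia.
rewrite /cutset; split=> -[sx dx [y xy rb]].
  by split; [exact/n1|rewrite -ax|exists y; [rewrite -Ex|exact/shell]].
move/n1 in sx; split=> //; first by rewrite ax.
by exists y; [rewrite Ex|exact/shell].
Qed.

Lemma cut_rank_loc r s x : near E r o s -> r + rI <= T -> cand W E s ->
  cut_rank W E s x = cut_rank W E' s x.
Proof.
by move=> os rT cs; apply: eq_count => y; apply/asbool_equiv_eq; apply: cut_loc os rT cs.
Qed.

Lemma cut_color_loc r x c : near E r o x -> r + rI + 1 <= T ->
  cut_color W E x c <-> cut_color W E' x c.
Proof.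
move=> ox rT.
have near_s s : near E 1 s x -> near E (r + 1) o s.
  by move=> sx; apply: near_trans ox (near_sym ES sx).
have near_s' s : near E' 1 s x -> near E (r + 1) o s.
  move=> sx; apply: (near_trans ox).
  by apply: (proj2 (near_loc ag _ ox _) (near_sym ES' sx)); lia.
split=> -[s [ss sx ->]]; exists s.
  have [sx1 _ _] := sx; have os := near_s _ sx1.
  have cs := selected_cand ss.
  split; [apply: (proj1 (selected_loc os _) ss)|apply: (proj1 (cut_loc _ os _ cs) sx)
         |apply: cut_rank_loc os _ _] => //.
  1-3: rewrite /rI in rT *; lia.
have [sx1 _ _] := sx; have os := near_s' _ sx1.
have {}ss : selected W E s by apply: (proj2 (selected_loc os _) ss); rewrite /rI in rT *; lia.
have cs := selected_cand ss.
split=> //; [apply: (proj2 (cut_loc _ os _ cs) sx)|apply: esym; apply: cut_rank_loc os _ _] => //.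
all: rewrite /rI in rT *; lia.
Qed.

Lemma on_cutE W' F x : on_cut W' F x <-> exists c, cut_color W' F x c.
Proof.
split=> [[s ss sx]|[c [s [ss sx _]]]]; last by exists s.
by exists (cut_rank W' F s x), s.
Qed.

Lemma on_cut_loc r x : near E r o x -> r + rI + 1 <= T -> on_cut W E x <-> on_cut W E' x.
Proof.
by move=> ox rT; rewrite !on_cutE; split=> -[c /(cut_color_loc _ ox rT) h]; exists c.
Qed.

Lemma piece_loc r x y : near E r o x -> r + rI + DP + 2 <= T ->
  piece W E x y <-> piece W E' x y.
Proof.
move=> ox rT; apply: reach_iff => u v xu.
have ou : near E (r + DP) o u by exact: near_trans ox (pieceD (near_conn ox) xu).
have Eu : E u =1 E' u by apply: ag; apply: near_mono ou; lia.
rewrite -Eu; split=> -[uv nu nv]; split=> //.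
- by move=> h; apply: nu; apply: (proj2 (on_cut_loc ou _) h); lia.
- by move=> h; apply: nv; apply: (proj2 (on_cut_loc (near_step ou uv) _) h); lia.
- by move=> h; apply: nu; apply: (proj1 (on_cut_loc ou _) h); lia.
- by move=> h; apply: nv; apply: (proj1 (on_cut_loc (near_step ou uv) _) h); lia.
Qed.

Lemma color_loc : rI + DP + 2 <= T -> color W E o = color W E' o.
Proof.
move=> rT; have oo := near0 E 0 o.
have cc c : cut_color W E o c <-> cut_color W E' o c by apply: (cut_color_loc _ oo); lia.
have oc : on_cut W E o <-> on_cut W E' o by apply: (on_cut_loc oo); lia.
have pl y : piece W E o y <-> piece W E' o y by apply: (piece_loc _ oo); lia.
have ext M f : extends W E o M f <-> extends W E' o M f.
  have row x : piece W E o x -> E x =1 E' x.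
    move=> ox; apply: ag; apply: near_mono (pieceD _ ox); first by lia.
    exact: conn_refl.
  have ccy x y c : piece W E o x -> E x y -> cut_color W E y c <-> cut_color W E' y c.
    move=> ox xy; have nx : near E DP o x by apply: (pieceD _ ox); apply: conn_refl.
    by apply: (cut_color_loc _ (near_step nx xy)); lia.
  split=> -[e1 e2]; split.
  - by move=> x /pl /e1.
  - move=> x y /pl ox; rewrite -(row x ox) => xy; have [h1 h2] := e2 _ _ ox xy.
    by split; [move=> /pl|move=> c /(ccy _ _ _ ox xy)]; auto.
  - by move=> x /pl /e1.
  - move=> x y ox xy; have xy' := xy; rewrite (row x ox) in xy'.
    have [h1 h2] := e2 _ _ ((pl _).1 ox) xy'.
    by split; [move=> /pl|move=> c /(ccy _ _ _ ox xy)]; auto.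
rewrite /color; case: pselect => [h|h]; case: pselect => [h'|h'].
- by congr pick_or; apply/funext => c; apply/propext.
- by case: h'; apply/oc.
- by case: h; apply/oc.
congr ((pick_or _ _).2 _); apply/funext => -[M f]; apply/propext; rewrite /optimal /=.
by split=> -[/ext h1 h2]; split=> // M' f' /ext; apply: h2.
Qed.
End Locality.

(** * Diameters of the pieces *)

Lemma maximal_packing (r : nat -> nat -> Prop) (s : seq nat) :
  (forall x, r x x) -> (forall x y, r x y -> r y x) ->
  exists t : seq nat, [/\ {subset t <= s},
    forall y z, y \in t -> z \in t -> r y z -> y = z
    & forall y, y \in s -> exists2 z, z \in t & r y z].
Proof.
move=> rxx rC; elim: s => [|x s [t [ts tI tM]]]; first by exists [::].
have [[z zt xz]|no] := pselect (exists2 z, z \in t & r x z).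
  exists t; split=> [y /ts|//|y]; first by rewrite inE => ->; rewrite orbT.
  by rewrite inE => /orP[/eqP ->|/tM//]; exists z.
exists (x :: t); split=> [y|y z|y].
- by rewrite !inE => /orP[->//|/ts ->]; rewrite orbT.
- rewrite !inE => /orP[/eqP->|yt] /orP[/eqP->|zt] //; last exact: tI.
    by move=> xz; case: no; exists z.
  by move=> /rC yx; case: no; exists y.
rewrite inE => /orP[/eqP ->|/tM[z zt yz]]; first by exists x; rewrite ?inE ?eqxx.
by exists z => //; rewrite inE zt orbT.
Qed.

(** Quotients by [2 ^ i] differ at [i = 0] and agree for large [i]; the bit differs where they
    become equal. *)
Lemma top_bit_differs x y : x <> y -> exists i,
  x %/ 2 ^ i.+1 = y %/ 2 ^ i.+1 /\ odd (x %/ 2 ^ i) != odd (y %/ 2 ^ i).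
Proof.
move=> xy; have [| |i _ [ni eqi]] :=
  first_crossing (P := fun i => x %/ 2 ^ i = y %/ 2 ^ i) (n := x + y).
- by rewrite !divn1.
- by rewrite !divn_small //; apply: leq_ltn_trans (ltn_expl (x + y) (isT : 1 < 2)); lia.
exists i; split=> //; apply: contra_notN ni => /eqP od.
move: eqi; rewrite expnS mulnC !divnMA !divn2 => eqi.
by rewrite -[LHS]odd_double_half -[RHS]odd_double_half od eqi.
Qed.

Lemma cut_adj W E s x y : symmetric E -> irreflexive E -> chordal_rel E -> 0 < W ->
  selected W E s -> cut W E s x -> cut W E s y -> x = y \/ E x y.
Proof.
move=> ES EI chordE W0 /selected_cand /armsP [i [_ _ _ _ [sa sb ab]]].
by apply: (cutset_adj ES EI chordE _ sa sb); lia.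
Qed.

Section Analysis.
Variables (E : rel nat) (W : nat).
Hypothesis ES : symmetric E.
Hypothesis EI : irreflexive E.
Hypothesis chordE : chordal_rel E.
Hypothesis W_large : 200 <= W.
Variables (o : nat) (vs : seq nat) (N : nat).
Hypothesis con : forall x, conn E o x -> x \in vs.
Hypothesis idN : forall x, conn E o x -> x < 2 ^ N.

(** The component of [o] as a type, on which [dist] is a true metric and the hyperbolic results
    apply. *)
Let T := {x : nat | `[< conn E o x >]}.
Let d (x y : T) := dist E (val x) (val y).
Let lev i (x : T) := level W E i (val x).

Let cT (x : T) : conn E o (val x). Proof. exact/asboolP/(valP x). Qed.
Let cTT (x y : T) : conn E (val x) (val y).
Proof. exact: conn_trans (conn_sym ES (cT x)) (cT y). Qed.
Let mk x (c : conn E o x) : T := exist _ x (introT (asboolP _) c).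

Let dxx x : d x x = 0. Proof. exact: distxx. Qed.
Let dC x y : d x y = d y x. Proof. exact: dist_sym. Qed.
Let dT x y z : d x z <= d x y + d y z. Proof. exact: dist_tri. Qed.

Let geo x y : exists p : nat -> T, [/\ p 0 = x, p (d x y) = y
  & forall i j, i <= j -> j <= d x y -> d (p i) (p j) = j - i].
Proof.
have [p [p0 pn _ pc pd]] := geodesic ES (cTT x y).
have pP i : i <= d x y -> val (insubd x (p i)) = p i.
  by move=> le; rewrite insubdK //; apply/asboolP; apply: conn_trans (cT x) (pc i le).
exists (fun i => insubd x (p i)); split.
- by apply: val_inj; rewrite pP.
- by apply: val_inj; rewrite pP.
- by move=> i j ij jn; rewrite /d !pP ?pd //; apply: leq_trans jn.
Qed.

Let sep u v p : 0 < d u v -> d u p + d p v = d u v ->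
  exists A : T -> Prop, [/\ A u, ~ A v & forall x y, A x -> ~ A y ->
    exists q, d x q + d q y = d x y /\ d q p <= 1].
Proof.
move=> uv0 upv.
have [A [Au nAv cross]] := geodesic_separates ES EI chordE (cTT u p) (cTT u v) uv0 upv.
exists (fun x => A (val x)); split=> // x y Ax nAy.
have [q [cq qb qp]] := cross _ _ (cTT u x) (cTT u y) Ax nAy.
by exists (mk (conn_trans (cT u) cq)).
Qed.

Let lev0 x : lev 0 x. Proof. by []. Qed.

Let levS i x : lev i.+1 x <-> exists y, d x y <= 14 * W /\ exists a1 a2 a3,
  [/\ arm d (15 * W) (43 * W) lev i y a1, arm d (15 * W) (43 * W) lev i y a2
    & arm d (15 * W) (43 * W) lev i y a3] /\
  [/\ spread d y a1 a2, spread d y a1 a3 & spread d y a2 a3].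
Proof.
split=> [[y [xy [a1 [a2 [a3 [[[l1 d1] [l2 d2] [l3 d3]] S]]]]]]|].
  have cy : conn E o y by apply: conn_trans (cT x) (near_conn xy).
  have ca a : 15 * W <= dist E y a <= 43 * W -> conn E o a.
    by move=> /andP[h _]; apply: conn_trans cy (dist_ge_conn _ h); lia.
  exists (mk cy); split; first exact: dist_le.
  by exists (mk (ca _ d1)), (mk (ca _ d2)), (mk (ca _ d3)).
move=> [y [xy [a1 [a2 [a3 [[[l1 d1] [l2 d2] [l3 d3]] S]]]]]].
exists (val y); split; first exact/(near_distP _ (cTT x y)).
by exists (val a1), (val a2), (val a3).
Qed.

Let armedT i (x a b : T) : armed d (29 * W) lev i x a b <->
  armed_at W E i (val x) (val a) (val b).
Proof.
by rewrite /armed /armed_at /d (_ : 2 * (29 * W) = 58 * W) //; lia.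
Qed.

Let has_armsT x a b : conn E o x -> has_arms W E x a b -> conn E o a /\ conn E o b.
Proof.
move=> cx [i [_ _ _ _ [xa xb _]]].
by split; apply: conn_trans cx (dist_gt0_conn _); lia.
Qed.

Let candT (x : T) : candidate d (29 * W) lev x <-> cand W E (val x).
Proof.
split=> [[i [a [b /armedT A]]]|[a [b A]]]; first by exists (val a), (val b), i.
have [ca cb] := has_armsT (cT x) A; case: A => i A.
by exists i, (mk ca), (mk cb); apply/armedT.
Qed.

Let nearT r (x y : T) : near E r (val x) (val y) <-> d x y <= r.
Proof. exact: near_distP. Qed.

(** A vertex removed in a round has a close survivor with the current bit clear, which survives that
    round too. So each of the [l] remaining bits costs at most one hop. *)
Let alive_hops l j (x : T) : j + l = N -> alive W E j (val x) ->
  hops d W (29 * W) lev (fun z => ruling W E (val z)) l x.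
Proof.
have hopsS h (z : T) : hops d W (29 * W) lev (fun z => ruling W E (val z)) h z ->
    hops d W (29 * W) lev (fun z => ruling W E (val z)) h.+1 z.
  elim: h z => [|h IH] z [rz|]; try by left.
  by move=> [z' [cz zz' hz]]; right; exists z'; split=> //; apply: IH.
elim: l j x => [|l IH] j x jl ax.
  by left; apply/(ruling_alive _ _ (idN (cT x))); rewrite -jl addn0.
have [ax'|nax] := pselect (alive W E j.+1 (val x)).
  by apply: hopsS; apply: (IH j.+1) => //; lia.
have [od [y [ay xy yx ev]]] : odd (val x %/ 2 ^ j) /\ exists y,
    [/\ alive W E j y, near E W (val x) y, y %/ 2 ^ j.+1 = val x %/ 2 ^ j.+1
      & ~~ odd (y %/ 2 ^ j)].
  by apply: contrapT => nk; apply: nax.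
have cy : conn E o y by apply: conn_trans (cT x) (near_conn xy).
right; exists (mk cy); split.
- by apply/candT; apply: (alive_anti (i := 0) _ ay).
- exact/nearT.
apply: (IH j.+1); first by lia.
by split=> // -[]; rewrite (negbTE ev).
Qed.

Lemma linked_conn x y : linked W E x y -> conn E x y.
Proof.
elim=> [|u v _ xu [uv _]]; first exact: conn_refl.
exact: conn_trans xu (near_conn uv).
Qed.

Lemma linked_diameter x y : conn E o x -> free W E x -> linked W E x y ->
  near E ((6 * N + 24) * W) x y.
Proof.
move=> cx fx xy; have cy := conn_trans cx (linked_conn xy).
apply/(nearT _ (mk cx) (mk cy)).
apply: (chain_diameter dxx dC dT geo sep W_large erefl erefl erefl erefl lev0 levS
  (ruler := fun z => ruling W E (val z)) (X := fun z => free W E (val z))) => //.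
- by move=> z [/candT].
- by move=> z r [_ far] rr; rewrite ltnNge; apply/negP => /nearT; apply: far.
- by move=> z /candT cz; apply: (alive_hops (j := 0)).
elim: xy {fx} cy => [|u v xu IH [uv fv]] cv.
  by rewrite (_ : mk cv = mk cx); [exact: reach_refl|apply: val_inj].
have cu := conn_trans cx (linked_conn xu).
by apply: (reach_step (IH cu)); split=> //; apply/nearT.
Qed.

Lemma linked_free x y : free W E x -> linked W E x y -> free W E y.
Proof. by move=> fx; case=> // u v _ []. Qed.

Lemma linked_sym x y : free W E x -> linked W E x y -> linked W E y x.
Proof.
move=> fx xy.
have nS u v : near E W u v -> near E W v u by apply: near_sym.
by have [] := reach_within_sym nS fx xy.
Qed.

Lemma packing_exists x : conn E o x -> exists M, packing W E x M.
Proof.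
move=> cx; pose s := [seq y <- vs | `[< linked W E x y >]].
have inS y : y \in s <-> linked W E x y.
  rewrite mem_filter; split=> [/andP[/asboolP]//|xy]; apply/andP; split; first exact/asboolP.
  by apply: con; apply: conn_trans cx (linked_conn xy).
have [t [ts tI tM]] := maximal_packing s (near0 E W) (fun x y => near_sym ES (y := y)).
exists (fun y => y \in t); split=> // [y /ts /inS //|y /inS]; exact: tM.
Qed.

Lemma fillerP x : conn E o x -> packing W E x (filler W E x).
Proof. by move=> /packing_exists; apply: pick_orP. Qed.

Lemma filler_linked x y : free W E x -> linked W E x y -> filler W E x = filler W E y.
Proof.
move=> fx xy; congr pick_or; apply/funext => M; apply/propext.
have yx := linked_sym fx xy.
have lk z : linked W E x z <-> linked W E y z.
  by split; apply: reach_trans.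
by split=> -[M1 M2 M3]; split=> // z; [move=> /M1/lk|move=> /lk/M3|move=> /M1/lk|move=> /lk/M3].
Qed.

Lemma selected_dominates x : conn E o x -> cand W E x ->
  exists2 s, selected W E s & near E W x s.
Proof.
move=> cx candx; have [[r rr xr]|no] := pselect (exists2 r, ruling W E r & near E W x r).
  by exists r => //; left.
have fx : free W E x by split=> // r rr xr; apply: no; exists r.
have [M1 M2 M3] := fillerP cx.
have [z Mz xz] := M3 x reach_refl; have lz := M1 _ Mz.
exists z => //; right; split; first exact: linked_free lz.
by rewrite -(filler_linked fx lz).
Qed.

(** Of two close ruling vertices, the one with the top differing bit set would be removed by the
    other. Free vertices are far from ruling ones, and two close free vertices share a filler. *)
Lemma selected_separated s s' : conn E o s -> selected W E s -> selected W E s' ->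
  near E W s s' -> s = s'.
Proof.
move=> cs [rs|[fs Ms]] [rs'|[fs' Ms']] ss'.
- apply: contrapT => /top_bit_differs[i [eqi odi]].
  have clash x y : ruling W E x -> ruling W E y -> near E W x y ->
      x %/ 2 ^ i.+1 = y %/ 2 ^ i.+1 -> odd (x %/ 2 ^ i) -> ~~ odd (y %/ 2 ^ i) -> False.
    move=> rx ry xy exy ox oy; have [_ []] := rx i.+1; split=> //.
    by exists y; split=> //; exact: ry.
  case: (boolP (odd (s %/ 2 ^ i))) odi => od; case: (boolP (odd (s' %/ 2 ^ i))) => // od' _.
    exact: (clash s s').
  by apply: (clash s' s) => //; apply: near_sym.
- by case: fs' => _ /(_ s rs); case; apply: near_sym.
- by case: fs => _ /(_ s' rs').
have lk : linked W E s s' by apply: reach_step reach_refl _.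
have [M1 M2 M3] := fillerP cs.
by apply: M2 => //; rewrite (filler_linked fs lk).
Qed.

Lemma piece_sym x y : piece W E x y -> piece W E y x.
Proof. by apply: reach_sym => u v [uv nu nv]; split=> //; rewrite ES. Qed.

Lemma piece_conn x y : piece W E x y -> conn E x y.
Proof. by elim=> [|u v _ xu [uv _ _]]; [exact: conn_refl|exact: conn_edge uv]. Qed.

Variable K : nat.
Hypothesis vsK : size vs < 2 ^ K.

Lemma no_level x : conn E o x -> ~ level W E K.+1 x.
Proof.
move=> cx lx; have := vsK; rewrite ltnNge => /negP; apply.
apply: (lev_bound dxx dC dT geo sep W_large erefl erefl erefl erefl levS (x := mk cx)) lx.
move=> s us; rewrite -(size_map val); apply: uniq_leq_size.
  by rewrite map_inj_uniq //; apply: val_inj.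
by move=> y /mapP[z _ ->]; apply: con.
Qed.

(** A longer geodesic contains an armed vertex, and a selected [s] lies within [W] of it. The cut
    clique of [s] then separates [x] from [y], although the piece avoids all cut cliques. *)
Lemma piece_diameter x y : conn E o x -> piece W E x y ->
  near E (58 * W * K.+2) x y.
Proof.
move=> cx xy; have cy := conn_trans cx (piece_conn xy).
pose u := mk cx; pose v := mk cy; apply/(nearT _ u v).
rewrite leqNgt; apply/negP => far.
have [p [p0 pn gp]] := geo u v.
have [|t [i [Lt tn A]]] := armed_on_geodesic dC W_large erefl erefl erefl erefl
  lev0 levS (K := K.+1) (fun x => no_level (cT x)) gp; first by lia.
have ct : cand W E (val (p t)) by apply/candT; exists i, (p (t - 29 * W)), (p (t + 29 * W)).
have [s ss ps] := selected_dominates (cT _) ct.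
have cs : conn E o s by apply: conn_trans (cT _) (near_conn ps).
have hs := armsP (selected_cand ss); have [ca cb] := has_armsT cs hs.
have [j S] := hs; have [_ _ _ _ [sa sb ab]] := S.
have walk w z : piece W E w z -> reach (fun x y => E x y /\ ~ cut W E s y) w z.
  by apply: reach_sub => e f _ [ef _ nf]; split=> // cf; apply: nf; exists s.
have cut_sep := cutset_separates ES EI chordE _ sa sb.
pose sT := mk cs; pose aT := mk ca; pose bT := mk cb.
have ST : armed d (29 * W) lev j sT aT bT by apply/armedT.
have ut : d u (p (t - 29 * W)) + 29 * W = d u (p t) by rewrite -p0 !gp; lia.
have vt : d v (p (t + 29 * W)) + 29 * W = d v (p t).
  by rewrite !(dC v) -pn !gp; lia.
have [[h1 h2]|[h1 h2]] := armed_separates dxx dC dT geo sep W_large erefl erefl erefl erefl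
  lev0 levS A ST ((nearT _ _ sT).1 ps) ut vt.
- apply: (cut_sep _ _ x y); [lia|lia|..].
  + exact: conn_trans (conn_sym ES ca) cy.
  + exact/walk/piece_sym.
  + by apply: leq_trans h2; rewrite addn1 ltnS leqnSn.
  + exact: h1.
apply: (cut_sep _ _ y x); [lia|lia|..].
- exact: conn_trans (conn_sym ES ca) cx.
- exact: walk.
- by apply: leq_trans h1; rewrite addn1 ltnS leqnSn.
- exact: h2.
Qed.

End Analysis.

(** * Properness and number of colours *)

Section Coloring.
Variables (E : rel nat) (k q m : nat) (f0 : nat -> nat) (vs : seq nat).
Hypothesis ES : symmetric E.
Hypothesis EI : irreflexive E.
Hypothesis chordE : chordal_rel E.
Hypothesis vsE : forall x y, E x y -> x \in vs.
Hypothesis f0E : forall x y, E x y -> f0 x <> f0 y.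
Hypothesis f0k : forall x, f0 x < k.
Hypothesis kmq : k <= m * q.
Let W := 4 * m + 200.

Lemma conn_vs o x : o \in vs -> conn E o x -> x \in vs.
Proof.
move=> ovs [r /near_last[<-//|[z zx]]].
by apply: (vsE (y := z)); rewrite ES.
Qed.

Let selected_vs s : selected W E s -> s \in vs.
Proof.
move=> /selected_cand/armsP[i [_ _ _ _ [sa _ _]]].
have csa : conn E s (arms W E s).1 by apply: dist_gt0_conn; lia.
have [p [p0 _ pE _ _]] := geodesic ES csa.
by rewrite -p0; apply: vsE (pE 0 _); lia.
Qed.

Let sep s s' r : r <= W -> selected W E s -> selected W E s' -> near E r s s' -> s = s'.
Proof.
move=> rW ss ss' n; have svs := selected_vs ss.
apply: (selected_separated ES (fun x => conn_vs svs)) ss ss' (near_mono rW n).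
exact: conn_refl.
Qed.

Let W0 : 0 < W. Proof. by rewrite /W; lia. Qed.

Lemma cut_rank_inj s x y : cut W E s x -> cut W E s y ->
  cut_rank W E s x = cut_rank W E s y -> x = y.
Proof.
have lt u v : cut W E s u -> u < v -> cut_rank W E s u < cut_rank W E s v.
  move=> cu uv; rewrite /cut_rank -(subnKC uv) iotaD count_cat add0n.
  have -> : iota 0 u.+1 = iota 0 u ++ [:: u] by rewrite -[u.+1]addn1 iotaD.
  by rewrite count_cat /= asboolT //; lia.
move=> cx cy e; case: (ltngtP x y) => // h; first by have := lt _ _ cx h; lia.
by have := lt _ _ cy h; lia.
Qed.

(** [f0] is injective on a clique, which therefore has at most [k] vertices. *)
Lemma cut_rank_lt s x : selected W E s -> cut W E s x -> cut_rank W E s x < k.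
Proof.
move=> ss cx; pose l := x :: [seq y <- iota 0 x | `[< cut W E s y >]].
have lcut y : y \in l -> cut W E s y.
  by rewrite inE mem_filter => /orP[/eqP ->//|/andP[/asboolP]].
have lu : uniq l.
  by rewrite /l /= filter_uniq ?iota_uniq // mem_filter mem_iota ltnn !andbF.
have lf : {in l &, injective f0}.
  move=> y z /lcut cy /lcut cz e.
  by have [//|/f0E] := cut_adj ES EI chordE W0 ss cy cz.
have : size (map f0 l) <= size (iota 0 k).
  apply: uniq_leq_size; first by rewrite map_inj_in_uniq.
  by move=> _ /mapP[y _ ->]; rewrite mem_iota add0n f0k.
by rewrite size_map size_iota /= size_filter.
Qed.

(** No node computes this colouring; it witnesses that every piece can be completed with [k + q]
    colours. *)
Lemma global_extension : exists g : nat -> nat,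
  [/\ forall x y, E x y -> g x <> g y, forall x, g x < k + q
    & forall s x, selected W E s -> cut W E s x -> g x = cut_rank W E s x].
Proof.
apply: (extend_coloring ES f0E f0k kmq).
- by move=> s s' ss ss' n; apply: sep n => //; rewrite /W; lia.
- by move=> s x _ [].
- by move=> s x y; apply: cut_adj.
- by move=> s x y _; apply: cut_rank_inj.
- exact: cut_rank_lt.
Qed.

Lemma optimal_exists v : exists Mf, optimal W E v Mf /\ Mf.1 <= k + q.
Proof.
have [g [gE gk gc]] := global_extension.
have ext : extends W E v (k + q) g.
  split=> [x _|x y _ xy]; first exact: gk.
  by split=> [_|c [s [ss cy ->]]]; [exact: gE|rewrite -(gc _ _ ss cy); apply: gE].
have ex : exists M, `[< exists f, extends W E v M f >].
  by exists (k + q); apply/asboolP; exists g.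
case: (ex_minnP ex) => M /asboolP[f ef] minM.
exists (M, f); split; last by apply: minM; apply/asboolP; exists g.
by split=> // M' f' ef'; apply: minM; apply/asboolP; exists f'.
Qed.

Lemma on_cut_color v : on_cut W E v -> exists s,
  [/\ selected W E s, cut W E s v & color W E v = cut_rank W E s v].
Proof.
move=> cv; rewrite /color; case: pselect => // ? /=.
have [|s [ss sv e]] := @pick_orP _ 0 (cut_color W E v); last by exists s.
by case: cv => s ss sv; exists (cut_rank W E s v), s.
Qed.

Lemma piece_color v : ~ on_cut W E v -> exists Mf : nat * (nat -> nat),
  [/\ Mf = pick_or (0, fun=> 0) (optimal W E v), optimal W E v Mf, Mf.1 <= k + q
    & color W E v = Mf.2 v].
Proof.
move=> nv; rewrite /color; case: pselect => // ? /=.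
have [Mf [oMf le]] := optimal_exists v.
have opt := @pick_orP _ (0, fun=> 0) (optimal W E v) (ex_intro _ _ oMf).
exists (pick_or (0, fun=> 0) (optimal W E v)); split=> //.
exact: leq_trans (opt.2 _ _ oMf.1) le.
Qed.

Lemma color_lt v : color W E v < k + q.
Proof.
have [cv|nv] := pselect (on_cut W E v).
  have [s [ss sv ->]] := on_cut_color cv.
  by have := cut_rank_lt ss sv; lia.
have [Mf [_ [[lt _] _] le ->]] := piece_color nv.
by apply: leq_trans le; apply: lt; apply: reach_refl.
Qed.

Lemma color_proper u v : E u v -> color W E u <> color W E v.
Proof.
have mixed x y : E x y -> ~ on_cut W E x -> on_cut W E y -> color W E x <> color W E y.
  move=> xy nx cy; have [s [ss sy ->]] := on_cut_color cy.
  have [Mf [_ [[_ ext] _] _ ->]] := piece_color nx.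
  by apply: (ext x y reach_refl xy).2; exists s.
move=> uv; have [cu|nu] := pselect (on_cut W E u);
  have [cv|nv] := pselect (on_cut W E v).
- have [s [ss su ->]] := on_cut_color cu; have [s' [ss' sv ->]] := on_cut_color cv.
  have [n _ _] := su; have [n' _ _] := sv.
  (* A walk of length 3 joins the two centres, so they coincide, and ranks on one clique are
     distinct. *)
  have e : s = s'.
    apply: (@sep _ _ 3) => //; first by rewrite /W; lia.
    exact: near_trans (near_step n uv) (near_sym ES n').
  rewrite -e in sv *; move=> /(cut_rank_inj su sv) uv'.
  by rewrite uv' EI in uv.
- by move=> /esym; apply: mixed => //; rewrite ES.
- exact: mixed.
have puv : piece W E u v by apply: reach_step reach_refl _.
have [Mf [Me [[_ ext] _] _ ->]] := piece_color nu.
have [Mf' [Me' _ _ ->]] := piece_color nv.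
(* Both ends lie in one piece, so their predicates [optimal] coincide and pick the same
   colouring. *)
have -> : Mf' = Mf.
  rewrite Me Me'; congr pick_or; apply/funext => -[M f]; apply/propext.
  have pe x : piece W E v x <-> piece W E u x.
    by split; apply: reach_trans => //; apply: piece_sym.
  have exte M' f' : extends W E v M' f' <-> extends W E u M' f'.
    split=> -[e1 e2]; split=> [x /pe|x y /pe vx xy]; try exact: e1.
      by have [h1 h2] := e2 _ _ vx xy; split=> // /pe.
    by have [h1 h2] := e2 _ _ vx xy; split=> // /pe.
  rewrite /optimal /=.
  by split=> -[/exte h1 h2]; split=> // M' f' /exte; apply: h2.
exact: (ext u v reach_refl uv).1.
Qed.
End Coloring.

(** * The algorithm *)

Definition knows (E : rel nat) (known : seq (nat * seq nat)) : Prop :=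
  forall x ns, (x, ns) \in known -> forall y, E x y = (y \in ns).

(** The true graph is among the relations consistent with [known], so a unanimous colour is the
    right one; a node can stop without knowing [n] or a radius. *)
Definition decide W i known : option nat :=
  if pselect (exists c, forall E, symmetric E -> knows E known -> color W E i = c)
  is left h then Some (projT1 (cid h)) else None.

Lemma decideP W E i known c : symmetric E -> knows E known ->
  decide W i known = Some c -> c = color W E i.
Proof.
by move=> ES EK; rewrite /decide; case: pselect => // h [<-]; case: cid => /= c' ->.
Qed.

Definition gather_state := (option nat * (nat * seq (nat * seq nat)))%type.

Definition gather_step W (s : gather_state) (ms : seq (nat * seq (nat * seq nat))) :
    gather_state :=
  let known := s.2.2 ++ flatten [seq p.2 | p <- ms] in
  (if s.1 is Some c then Some c else decide W s.2.1 known, (s.2.1, known)).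

Lemma gather_stable W (s : gather_state) ms c :
  s.1 = Some c -> (gather_step W s ms).1 = Some c.
Proof. by move=> /= ->. Qed.

Definition gather W : local_algorithm :=
  @LocalAlgorithm gather_state (seq (nat * seq nat))
    (fun i ns => (decide W i [:: (i, ns)], (i, [:: (i, ns)])))
    (fun s _ => s.2.2) (gather_step W) (fun s => s.1) (@gather_stable W).

(** * Running the gathering algorithm on a graph *)

Section Simulation.
Variables (G : sgraph) (id : G -> nat).
Hypothesis idI : injective id.

Definition id_rel : rel nat := fun x y =>
  [exists u : G, [exists v : G, [&& id u == x, id v == y & adj u v]]].

Lemma id_relP x y : reflect (exists u v, [/\ id u = x, id v = y & adj u v]) (id_rel x y).
Proof.
apply: (iffP existsP) => [[u /existsP[v /and3P[/eqP ? /eqP ? ?]]]|[u [v [<- <- uv]]]].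
  by exists u, v.
by exists u; apply/existsP; exists v; rewrite !eqxx.
Qed.

Lemma id_relE u v : id_rel (id u) (id v) = adj u v.
Proof.
by apply/id_relP/idP => [[u' [v' [/idI -> /idI ->]]]//|uv]; exists u, v.
Qed.

Lemma id_rel_sym : symmetric id_rel.
Proof.
have half x y : id_rel x y -> id_rel y x.
  by move=> /id_relP[u [v [<- <- uv]]]; rewrite id_relE adj_sym.
by move=> x y; apply/idP/idP; apply: half.
Qed.

Lemma id_rel_irrefl : irreflexive id_rel.
Proof.
move=> x; apply/negbTE/negP => /id_relP[u [v [<- /idI ->]]].
by rewrite adj_irrefl.
Qed.

Lemma id_rel_chordal : chordal G -> chordal_rel id_rel.
Proof.
move=> chG c /andP[cc uc] sz.
have pre x : x \in c -> exists u, id u = x.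
  by move=> /(next_cycle cc) /id_relP[u [_ [ux _ _]]]; exists u.
have [c' cE] : exists c', c = map id c'.
  elim: c pre {cc uc sz} => [|x s IH] pre; first by exists [::].
  have [|s' ->] := IH; first by move=> y ys; apply: pre; rewrite inE ys orbT.
  by have [|u <-] := pre x; [rewrite inE eqxx|exists (u :: s')].
rewrite cE in cc uc sz *; rewrite size_map in sz.
have uc' : uniq c' by move: uc; rewrite map_inj_uniq.
have cc' : cycle (@adj G) c'.
  by move: cc; rewrite cycle_map; apply: sub_cycle => u v; rewrite /= id_relE.
have [||x [y [xc yc xy nyx nxy]]] := chG c' => //; first by apply/andP.
exists (id x), (id y); rewrite !(mem_map idI) id_relE !next_map // !(inj_eq idI).
by split.
Qed.

Lemma neighborsP (u : G) y : (y \in [seq id w | w <- neighbors id u]) = id_rel (id u) y.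
Proof.
apply/mapP/id_relP => [[w]|[u' [w [/idI <- <- uw]]]].
  by rewrite mem_sort mem_enum => uw ->; exists u, w.
by exists w; rewrite // mem_sort mem_enum.
Qed.

Variable W : nat.

Lemma run_gather t v : let s := run (gather W) id t v in
  [/\ s.2.1 = id v,
      forall x ns, (x, ns) \in s.2.2 ->
        exists u, x = id u /\ ns = [seq id w | w <- neighbors id u],
      forall u, near id_rel t (id v) (id u) ->
        (id u, [seq id w | w <- neighbors id u]) \in s.2.2,
      forall c, decide W s.2.1 s.2.2 = Some c -> exists c', s.1 = Some c'
    & forall c, s.1 = Some c -> c = color W id_rel (id v)].
Proof.
have sound (known : seq (nat * seq nat)) : (forall x ns, (x, ns) \in known ->
    exists u, x = id u /\ ns = [seq id w | w <- neighbors id u]) -> knows id_rel known.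
  by move=> h x ns /h[u [-> ->]] y; rewrite neighborsP.
elim: t v => [|t IH] v /=.
  have h x ns : (x, ns) \in [:: (id v, [seq id w | w <- neighbors id v])] ->
      exists u, x = id u /\ ns = [seq id w | w <- neighbors id u].
    by rewrite inE => /eqP[-> ->]; exists v.
  split=> // [u /idI <-|c ->|c /(decideP id_rel_sym (sound _ h))//]; last by exists c.
  by rewrite inE.
have [s1 s2 s3 s4 s5] := IH v.
set known := _ ++ _; have known_sound x ns : (x, ns) \in known ->
    exists u, x = id u /\ ns = [seq id w | w <- neighbors id u].
  rewrite mem_cat => /orP[/s2//|/flattenP[l /mapP[p /mapP[u _ ->] ->]]] /=.
  by have [_ h _ _ _] := IH u; apply: h.
split=> //.
- move=> u vu1; have : near id_rel t.+1 (id v) (id u) by [].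
  move=> /(near_sym id_rel_sym)[/(near_sym id_rel_sym) vu|[z uz zv]].
    by rewrite mem_cat (s3 _ vu).
  have /id_relP[w [v' [wz /idI vv' wv]]] := zv; rewrite -wz in uz; rewrite vv' in wv.
  have [_ _ w3 _ _] := IH w; rewrite mem_cat; apply/orP; right.
  apply/flattenP; exists (run (gather W) id t w).2.2; last exact/w3/(near_sym id_rel_sym)/uz.
  apply/mapP; exists (id w, (run (gather W) id t w).2.2) => //.
  rewrite adj_sym in wv; by apply/mapP; exists w; rewrite // mem_sort mem_enum.
- move=> c; case: (run (gather W) id t v).1 => [c'|] h; first by exists c'.
  by exists c.
- move=> c; case e: (run (gather W) id t v).1 => [c'|]; first by move=> [<-]; apply: s5.
  by rewrite s1; apply: (decideP id_rel_sym (sound _ known_sound)).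
Qed.

(** The rows gathered cover the ball of radius [R], so every consistent relation agrees with the
    true one there. Separating [T] from [R] allows 0 rounds on a single vertex. *)
Lemma gather_computes T R : (forall v E', symmetric E' -> agree id_rel E' (id v) R ->
    color W E' (id v) = color W id_rel (id v)) ->
  (forall v u, near id_rel R (id v) (id u) -> near id_rel T (id v) (id u)) ->
  computes_within (gather W) id T (fun v => color W id_rel (id v)).
Proof.
move=> loc RT v; have [s1 s2 s3 s4 s5] := run_gather T v.
rewrite /=; set s := run _ _ _ _ in s1 s2 s3 s4 s5 *.
have [c e] : exists c, decide W s.2.1 s.2.2 = Some c.
  rewrite /decide; case: pselect => [h|[]]; first by exists (projT1 (cid h)).
  exists (color W id_rel (id v)) => E' ES' kE'; rewrite s1; apply: loc => // x vx y.
  have [u ux] : exists u, id u = x.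
    have [<-|[z /id_relP[_ [u [_ <- _]]]]] := near_last vx; first by exists v.
    by exists u.
  rewrite -ux in vx *; rewrite -neighborsP.
  exact/esym/(kE' _ _ (s3 _ (RT _ _ vx))).
by have [c' ec'] := s4 _ e; rewrite ec' (s5 _ ec').
Qed.
End Simulation.

(** * Number of rounds and approximation ratio *)

Import Order.TTheory GRing.Theory Num.Theory.

(** The radius [rI + DP + 2] of [color_loc] for the level bound [K.+1], with both diameter bounds
    inserted. *)
Definition gather_radius m K N :=
  let W := 4 * m + 200 in
  K.+4 * (200 * W) + N * W + (6 * N + 24) * W + 3 * W + 200 * W + 58 * W * K.+2 + 2.

Lemma color_radius (G : sgraph) (id : G -> nat) (m K N : nat) :
  chordal G -> injective id -> #|G| < 2 ^ K -> (forall v, id v < 2 ^ N) ->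
  forall v E', symmetric E' -> agree (id_rel id) E' (id v) (gather_radius m K N) ->
  color (4 * m + 200) E' (id v) = color (4 * m + 200) (id_rel id) (id v).
Proof.
move=> chG idI GK idN v E' ES' ag.
have ES := id_rel_sym idI; have EI := id_rel_irrefl idI.
have chE := id_rel_chordal idI chG.
pose vs := [seq id u | u : G].
have con x : conn (id_rel id) (id v) x -> x \in vs.
  move=> [r /near_last[<-|[z /id_relP[_ [u [_ <- _]]]]]]; exact: map_f (mem_enum _ _).
have vsK : size vs < 2 ^ K by rewrite size_map -cardE.
have vsN x : conn (id_rel id) (id v) x -> x < 2 ^ N.
  by move=> /con /mapP[u _ ->].
have Wl : 200 <= 4 * m + 200 by lia.
apply/esym/(color_loc _ ES ES' ag (K := K.+1) (N := N) (DX := (6 * N + 24) * (4 * m + 200))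
  (DP := 58 * (4 * m + 200) * K.+2)) => //; first by lia.
- exact: (no_level ES EI chE Wl con vsK).
- exact: (linked_diameter ES EI chE Wl vsN).
- exact: (piece_diameter ES EI chE Wl con vsK).
Qed.

Lemma color_legal (G : sgraph) (id : G -> nat) (m : nat) :
  0 < m -> 0 < #|G| -> chordal G -> injective id ->
  let col v := color (4 * m + 200) (id_rel id) (id v) in
  legal_coloring col /\ num_colors col <= chromatic_number G + (chromatic_number G %/ m).+1.
Proof.
move=> m0 G0 chG idI col; rewrite /chromatic_number; case: ex_minnP => k /existsP[f fP] _.
have ES := id_rel_sym idI; have EI := id_rel_irrefl idI.
have chE := id_rel_chordal idI chG.
have k0 : 0 < k.
  by have /card_gt0P[v _] := G0; apply: leq_ltn_trans (ltn_ord (f v)).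
pose f0 x : nat := if [pick u | id u == x] is Some u then f u else 0.
have f0id u : f0 (id u) = f u.
  by rewrite /f0; case: pickP => [w /eqP/idI -> //|/(_ u)]; rewrite eqxx.
have f0k x : f0 x < k by rewrite /f0; case: pickP.
have f0E x y : id_rel id x y -> f0 x <> f0 y.
  move=> /id_relP[u [v [<- <- uv]]]; rewrite !f0id => /val_inj /eqP; apply/negP.
  by move/forallP: fP => /(_ u)/forallP/(_ v)/implyP/(_ uv).
have vsE x y : id_rel id x y -> x \in [seq id u | u : G].
  by move=> /id_relP[u [_ [<- _ _]]]; apply: map_f (mem_enum _ _).
(* With [q = (k %/ m).+1] extra colours, [m] blocks of size [q] cover all [k] colours. *)
have kmq : k <= m * (k %/ m).+1 by have := ltn_ceil k m0; rewrite mulnC => /ltnW.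
split.
  apply/forallP => u; apply/forallP => v; apply/implyP => uv; apply/eqP.
  by apply: (color_proper ES EI chE vsE f0E f0k kmq); rewrite id_relE.
rewrite /num_colors -[leqRHS](size_iota 0); apply: uniq_leq_size; first exact: undup_uniq.
move=> c; rewrite mem_undup => /mapP[v _ ->]; rewrite mem_iota add0n.
exact: (color_lt ES EI chE vsE f0E f0k kmq).
Qed.

Lemma gather_radius_le m l c : 0 < m -> 0 < l ->
  gather_radius m l.+1 (l.+1 * c + 1) <= 204 * m * (2 * l * (1410 + 7 * c)).
Proof.
move=> m0 l0; rewrite /gather_radius; set W := 4 * m + 200.
have W1 : W <= 204 * m by rewrite /W; lia.
have W2 : 2 <= W by rewrite /W; lia.
apply: (@leq_trans (W * (2 * l * (1410 + 7 * c)))); last by rewrite leq_mul2r W1 orbT.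
have h1 : W <= W * l by rewrite leq_pmulr.
have h2 : W * c <= W * l * c by rewrite leq_mul2r h1 orbT.
have -> : l.+1 * c + 1 = l * c + c + 1 by lia.
move: W W2 h1 h2 {W1} => W W2 h1 h2.
by lia.
Qed.

Lemma chromatic_gt0 (G : sgraph) : 0 < #|G| -> 0 < chromatic_number G.
Proof.
move=> /card_gt0P[v _]; rewrite /chromatic_number; case: ex_minnP => k /existsP[f _] _.
exact: leq_ltn_trans (ltn_ord (f v)).
Qed.

Local Open Scope ring_scope.

Theorem theorem19 (R : realType) :
  exists A : R -> local_algorithm,
  forall c : nat, exists C : R,
  forall (G : sgraph) (id : G -> nat) (eps : R),
    (0 < #|G|)%N ->
    chordal G ->
    injective id ->
    (forall v : G, (id v <= #|G| ^ c)%N) ->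
    2 / (chromatic_number G)%:R <= eps ->
    exists (T : nat) (col : G -> nat),
      [/\ T%:R <= C * (Num.max 1 (1 / eps) * ln (#|G|%:R : R)),
          computes_within (A eps) id T col,
          legal_coloring col
        & (num_colors col)%:R <= (1 + eps) * (chromatic_number G)%:R].
Proof.
(* [m] is the least natural number above [2 / eps]; it depends on [eps] alone. *)
exists (fun eps => gather (4 * (Num.truncn (2 / eps)).+1 + 200)) => c.
(* 204 comes from [W <= 204 * m], 6 from [m <= 3 * M] and the factor 2 of [gather_radius_le], and
   [ln 2] from the binary logarithm [l]. *)
exists ((204 * 6 * (1410 + 7 * c))%:R / ln 2) => G id eps G0 chG idI idb epsb.
set m := (Num.truncn (2 / eps)).+1.
have k0 : 0 < (chromatic_number G)%:R :> R by rewrite ltr0n chromatic_gt0.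
have eps0 : 0 < eps by apply: lt_le_trans epsb; rewrite divr_gt0.
have m_gt : 2 / eps < m%:R by rewrite -truncn_le_nat.
have m_le : m%:R <= 2 / eps + 1.
  by rewrite /m -natr1 lerD2r truncn_le divr_ge0 // ltW.
have [legal few] := @color_legal G id m isT G0 chG idI.
pose l := trunc_log 2 #|G|; pose rad := gather_radius m l.+1 (l.+1 * c + 1)%N.
have GK : (#|G| < 2 ^ l.+1)%N by apply: trunc_log_ltn.
(* The added 1 makes the bound on identifiers strict. *)
have idN v : (id v < 2 ^ (l.+1 * c + 1))%N.
  apply: (leq_ltn_trans (idb v)); apply: (@leq_ltn_trans ((2 ^ l.+1) ^ c)).
    by case: (c) => // c'; rewrite leq_exp2r // ltnW.
  by rewrite -expnM ltn_exp2l // addn1.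
have comp T := gather_computes idI (T := T) (color_radius (m := m) chG idI GK idN).
have colors : (num_colors (fun v => color (4 * m + 200) (id_rel id) (id v)))%:R
    <= (1 + eps) * (chromatic_number G)%:R.
  move: few; set k := chromatic_number G in k0 epsb *; rewrite -(ler_nat R) => few.
  apply: (le_trans few); rewrite natrD -natr1.
  (* Half of [eps * k] pays for [k %/ m], as [m > 2 / eps]; the other half is at least 1 and pays
     for the successor. *)
  have h1 : 2 <= eps * k%:R by move: epsb; rewrite ler_pdivrMr.
  have h2 : (k %/ m)%:R * m%:R <= k%:R :> R by rewrite -natrM ler_nat leq_trunc_div.
  have h3 : (k %/ m)%:R * (2 / eps) <= k%:R.
    by apply: le_trans h2; rewrite ler_wpM2l // ltW.
  have h4 : (k %/ m)%:R * 2 <= k%:R * eps by move: h3; rewrite mulrA ler_pdivrMr.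
  by rewrite mulrDl mul1r lerD2l; lra.
(* For a single vertex the logarithm vanishes, so the decision must fall in round 0. *)
have [G1|G2] := leqP #|G| 1.
  exists 0%N, (fun v => color (4 * m + 200) (id_rel id) (id v)); split=> //.
    by rewrite (_ : #|G| = 1%N) ?ln1 ?mulr0 //; apply/eqP; rewrite eqn_leq G1.
  apply: comp => v u _.
  by have /fintype_le1P/(_ v)/(_ u) -> := G1.
exists rad, (fun v => color (4 * m + 200) (id_rel id) (id v)); split=> //; last exact: comp.
have l0 : (0 < l)%N by rewrite trunc_log_gt0.
have ln20 : 0 < ln 2 :> R by rewrite ln_gt0 // ltr1n.
have ll : l%:R * ln 2 <= ln #|G|%:R :> R.
  rewrite mulr_natl -lnXn ?ltr0n // ler_ln ?posrE ?exprn_gt0 ?ltr0n //.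
  by rewrite -natrX ler_nat trunc_logP.
set M := Num.max 1 _; have m3 : m%:R <= 3 * M.
  have : 1 <= M by rewrite le_max lexx.
  have : 1 / eps <= M by rewrite le_max lexx orbT.
  by rewrite -(mulr1 2) -mulrA in m_le; lra.
have M0 : 0 < M by rewrite lt_max ltr01.
have := gather_radius_le c (isT : 0 < m)%N l0; rewrite -(ler_nat R) => /le_trans; apply.
rewrite !natrM; set D := (1410 + 7 * c)%:R : R.
have D0 : 0 <= D by apply: ler0n.
have -> : 204%:R * 6%:R * D / ln 2 * (M * ln #|G|%:R) =
  204 * (3 * M) * (2 * (ln #|G|%:R / ln 2) * D) :> R by field; rewrite gt_eqF.
apply: ler_pM; rewrite ?mulr_ge0 //; first by rewrite ler_wpM2l.
by rewrite ler_wpM2r // ler_wpM2l // ler_pdivlMr.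
Qed.
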